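(* Let $\max\{f(S): S\in\mathcal{F}\}$ be an instance on a finite ground set $X$, where $f:2^X\to\mathbb{R}_{\ge 0}$ is nonnegative submodular and $\mathcal{F}\subseteq 2^X$, which is strongly symmetric with respect to a group $\mathcal{G}$ of permutations of $X$, and let $\gamma = \overline{OPT}/OPT$ be its symmetry gap. Let $\mathcal{C}$ be the class of instances $\max\{\tilde f(S): S\in\tilde{\mathcal{F}}\}$ where $\tilde f$ is nonnegative submodular and $\tilde{\mathcal{F}}$ is a refinement of $\mathcal{F}$ (for some $n\ge 1$). Then for every $\epsilon>0$, any (even randomized) $(1+\epsilon)\gamma$-approximation algorithm for the class $\mathcal{C}$ requires exponentially many value queries to $\tilde f$. Moreover, if $f$ is in addition monotone, the same conclusion holds for the class $\mathcal{C}$ restricted to instances where $\tilde f$ is nonnegative monotone submodular.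
   Context: Submodular: $f(S\cup T)+f(S\cap T)\le f(S)+f(T)$; monotone: $f(S)\le f(T)$ for $S\subseteq T$. Vectors in $\{0,1\}^X$ are identified with subsets of $X$. The multilinear extension of $f$ is $F(\mathbf{x})=\mathbf{E}[f(\hat{\mathbf{x}})]=\sum_{S\subseteq X} f(S)\prod_{i\in S}x_i\prod_{j\notin S}(1-x_j)$ for $\mathbf{x}\in[0,1]^X$, where $\hat{\mathbf{x}}$ rounds each coordinate independently to 1 with probability $x_i$. $P(\mathcal{F})=\mathrm{conv}\{\mathbf{1}_S: S\in\mathcal{F}\}$. For a permutation $\sigma$ of $X$, $\sigma(S)=\{\sigma(i): i\in S\}$ and $\sigma(\mathbf{x})$ is $\mathbf{x}$ with coordinates permuted by $\sigma$ (so $\sigma(\mathbf{1}_S)=\mathbf{1}_{\sigma(S)}$); the symmetrization is $\bar{\mathbf{x}}=\mathbf{E}_{\sigma\in\mathcal{G}}[\sigma(\mathbf{x})]$ with $\sigma$ uniform in $\mathcal{G}$. The instance is strongly symmetric with respect to $\mathcal{G}$ if $f(S)=f(\sigma(S))$ for all $S$ and $\sigma\in\mathcal{G}$, and $S\in\mathcal{F}\Leftrightarrow S'\in\mathcal{F}$ whenever $\overline{\mathbf{1}_S}=\overline{\mathbf{1}_{S'}}$. The symmetry gap is $\gamma=\overline{OPT}/OPT$ with $OPT=\max\{F(\mathbf{x}):\mathbf{x}\in P(\mathcal{F})\}$ and $\overline{OPT}=\max\{F(\bar{\mathbf{x}}):\mathbf{x}\in P(\mathcal{F})\}$. For $|X|=k$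 and $N=[n]$, $\tilde{\mathcal{F}}\subseteq 2^{N\times X}$ is a refinement of $\mathcal{F}$ if $\tilde{\mathcal{F}}=\{\tilde S\subseteq N\times X: (x_1,\dots,x_k)\in P(\mathcal{F})$ where $x_j=\frac1n|\tilde S\cap(N\times\{j\})|\}$. Instances in $\mathcal{C}$ are accessed through a value oracle for $\tilde f$ and a membership oracle for $\tilde{\mathcal{F}}$; ''exponentially many'' is in the size of the ground set $N\times X$. A $(1+\epsilon)\gamma$-approximation returns a feasible solution of (expected) value at least $(1+\epsilon)\gamma$ times the optimum. *)

(* Defs.v *)
From mathcomp Require Export all_boot all_order all_algebra all_fingroup.
From mathcomp Require Export all_classical all_reals all_analysis.

Set Implicit Arguments.
Unset Strict Implicit.
Unset Printing Implicit Defensive.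

Import Order.TTheory GRing.Theory Num.Theory.

Local Open Scope ring_scope.

Section SetFunctions.
Variables (R : realType) (T : finType).
Implicit Types (f : {set T} -> R) (S U : {set T}).

Definition nonneg_setfun f : Prop := forall S, 0 <= f S.

Definition submodular f : Prop :=
  forall S U, f (S :|: U) + f (S :&: U) <= f S + f U.

Definition monotone_setfun f : Prop := forall S U, S \subset U -> f S <= f U.

Definition ind (S : {set T}) : {ffun T -> R} := [ffun i => (i \in S)%:R].

Definition multilinear f (x : {ffun T -> R}) : R :=
  \sum_(S : {set T}) f S * \prod_(i in S) x i * \prod_(j in ~: S) (1 - x j).

Definition polytope (F : {set {set T}}) (x : {ffun T -> R}) : Prop :=
  exists lambda : {set T} -> R,
    [/\ forall S, S \in F -> 0 <= lambda S,
        \sum_(S in F) lambda S = 1 &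
        x = \sum_(S in F) lambda S *: ind S].

(* The inverse is what makes [permute s (ind S) = ind (s @: S)]. *)
Definition permute (s : {perm T}) (x : {ffun T -> R}) : {ffun T -> R} :=
  [ffun i => x ((s^-1)%g i)].

Definition symmetrize (G : {group {perm T}}) (x : {ffun T -> R}) :
    {ffun T -> R} :=
  (#|G|%:R)^-1 *: \sum_(s in G) permute s x.

Definition strongly_symmetric f (F : {set {set T}}) (G : {group {perm T}}) :
    Prop :=
  (forall S (s : {perm T}), s \in G -> f S = f (s @: S)) /\
  (forall S S', symmetrize G (ind S) = symmetrize G (ind S') ->
     (S \in F <-> S' \in F)).

(* Suprema of continuous functions over a compact set: both are maxima as soon
   as F is nonempty. *)
Definition OPT f (F : {set {set T}}) : R :=
  sup [set multilinear f x | x in [set x | polytope F x]]%classic.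

Definition OPTbar f (F : {set {set T}}) (G : {group {perm T}}) : R :=
  sup [set multilinear f (symmetrize G x) | x in [set x | polytope F x]]%classic.

Definition symmetry_gap f F G : R := OPTbar f F G / OPT f F.

End SetFunctions.

Section Refinement.
Variables (R : realType) (X : finType).

Definition density (n : nat) (S : {set 'I_n * X}) : {ffun X -> R} :=
  [ffun j => (n%:R)^-1 * #|[set u in S | u.2 == j]%SET|%:R].

Definition is_refinement (F : {set {set X}}) (n : nat)
    (Ft : {set {set 'I_n * X}}) : Prop :=
  forall S, S \in Ft <-> polytope F (density S).

(* A class of instances max {ft S : S in Ft} on the ground sets 'I_n * X. *)
Definition instance_class : Type :=
  forall n : nat, ({set 'I_n * X} -> R) -> {set {set 'I_n * X}} -> Prop.

Definition refinement_class (F : {set {set X}}) : instance_class :=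
  fun n ft Ft =>
    [/\ (0 < n)%N, nonneg_setfun ft, submodular ft & is_refinement F Ft].

Definition monotone_refinement_class (F : {set {set X}}) : instance_class :=
  fun n ft Ft => refinement_class F ft Ft /\ monotone_setfun ft.

End Refinement.

(* A deterministic adaptive algorithm on the ground set T: computation between
   oracle calls is free, each continuation receives the oracle's answer. *)
Inductive strategy (R : Type) (T : finType) : Type :=
| Return of {set T}
| AskValue of {set T} & (R -> strategy R T)
| AskMember of {set T} & (bool -> strategy R T).

Section Runs.
Variables (R : Type) (T : finType) (v : {set T} -> R) (Ft : {set {set T}}).

Fixpoint output (a : strategy R T) : {set T} :=
  match a with
  | Return B => B
  | AskValue B k => output (k (v B))
  | AskMember B k => output (k (B \in Ft))
  end.

Fixpoint value_queries (a : strategy R T) : nat :=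
  match a with
  | Return _ => 0
  | AskValue B k => (value_queries (k (v B))).+1
  | AskMember B k => value_queries (k (B \in Ft))
  end.

End Runs.

(* The random seed is a point of Omega.  Measurability says that the output and
   the number of value queries are (discrete) random variables. *)
Record rand_algorithm (R : realType) (X : finType) (d : measure_display)
    (Omega : measurableType d) := RandAlgorithm {
  strat : forall n : nat, Omega -> strategy R ('I_n * X)%type;
  measurable_output :
    forall n (v : {set 'I_n * X} -> R) (Ft S : {set _}),
      measurable [set w | output v Ft (strat n w) = S]%classic;
  measurable_value_queries :
    forall n (v : {set 'I_n * X} -> R) (Ft : {set _}) (q : nat),
      measurable [set w | value_queries v Ft (strat n w) = q]%classic
}.

Section Approximation.
Variables (R : realType) (X : finType).

(* For a nonnegative objective and a nonempty feasible family, the default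
   value 0 does not affect the maximum. *)
Definition opt_value (T : finType) (v : {set T} -> R) (Ft : {set {set T}}) : R :=
  \big[Num.max/0]_(S in Ft) v S.

Definition approximates (C : instance_class R X) (alpha : R)
    (d : measure_display) (Omega : measurableType d) (P : probability Omega R)
    (A : rand_algorithm R X Omega) : Prop :=
  forall (n : nat) (ft : {set 'I_n * X} -> R) (Ft : {set {set 'I_n * X}}),
    C n ft Ft ->
    {ae P, forall w, output ft Ft (strat A n w) \in Ft} /\
    ((alpha * opt_value ft Ft)%:E
       <= 'E_P[fun w => ft (output ft Ft (strat A n w))])%E.

(* The rate c and the threshold n0 depend on the class and on alpha, but not on
   the algorithm; queries are counted in expectation over the seed, which also
   bounds the worst case over the seed. *)
Definition requires_exponentially_many_queries (C : instance_class R X)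
    (alpha : R) : Prop :=
  exists (c : R) (n0 : nat), 0 < c /\
    forall (d : measure_display) (Omega : measurableType d)
      (P : probability Omega R) (A : rand_algorithm R X Omega),
      approximates C alpha P A ->
      forall n : nat, (n0 <= n)%N -> (0 < n)%N ->
      exists (ft : {set 'I_n * X} -> R) (Ft : {set {set 'I_n * X}}),
        C n ft Ft /\
        ((expR (c * #|{: 'I_n * X}|%:R))%:E
           <= 'E_P[fun w => (value_queries ft Ft (strat A n w))%:R])%E.

End Approximation.

(* Main.v *)
(* The algorithm cannot locate a hidden copy of the instance.  For permutations
   sigma_1, ..., sigma_n in G chosen at random, let xi_j(S) be the fraction of
   the i such that (i, sigma_i j) lies in S, and let the objective be
   Phi(xi(S)), where Phi is a perturbation of the multilinear extension F which
   agrees with a function Gam of the symmetrized point (close to F(bar x)) as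
   soon as xi(S) is close to its symmetrization.  The symmetrization of xi(S) is
   that of the density of S, so Gam does not depend on the sigma_i.  By
   Hoeffding, a query that does not depend on the sigma_i sees the difference
   between Phi and Gam with exponentially small probability.  Until this happens
   the algorithm runs as on the instance Gam, whose value on feasible sets is
   about OPTbar at most, whereas the optimum for Phi is about OPT at least.
   Hence an algorithm making few queries on Gam fails on some Phi.

   Phi = (1 - phi(D)) F(x) + phi(D) F(bar x) + damping, where D = |x - bar x|^2
   and phi goes from 1 to 0 so slowly that t phi'(t) and t^2 phi''(t) are small.
   As F(x) - F(bar x) = O(D), the cutoff contributes small errors to the second
   differences, and the damping term absorbs them.  Only differences with step
   1/n matter, so no calculus is needed. *)
Require Import Defs.
From mathcomp Require Import measurable_realfun ring lra.
Import Order.TTheory GRing.Theory Num.Theory.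
Local Open Scope ring_scope.
Set Implicit Arguments.
Unset Strict Implicit.
Unset Printing Implicit Defensive.

(** * The multilinear extension *)

Section Multilinear.
Variables (R : realType) (X : finType).
Implicit Types (f : {set X} -> R) (x y z : {ffun X -> R}) (S : {set X}).

Definition basis_vec (i : X) : {ffun X -> R} := [ffun j => (j == i)%:R].

(** Signs are controlled on the unit cube, but sizes are bounded with the limits -1 and 2, because a
    step from a symmetrized point can leave the unit cube. *)
Definition in_box (a b : R) x := forall j, a <= x j <= b.

(** The probability that rounding [x] gives [S], as one product over [X] from which a single
    coordinate can be split off. *)
Definition weight S x : R := \prod_i (if i \in S then x i else 1 - x i).

(** The multilinear extension of this set function is the partial derivative in direction [i]; its
    value does not depend on whether [i] lies in [S]. *)
Definition diff_set i f S : R := f (i |: S) - f (S :\ i).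

Lemma multilinearE f x : multilinear f x = \sum_S f S * weight S x.
Proof.
apply: eq_bigr => S _; rewrite -mulrA /weight [in RHS](bigID (mem S)) /=.
congr (_ * (_ * _)); first by apply: eq_bigr => i ->.
by apply: eq_big => i; rewrite ?inE // => /negbTE ->.
Qed.

Lemma add_stepE x t i j : (x + t *: basis_vec i) j = x j + t * (j == i)%:R.
Proof. by rewrite !ffunE. Qed.

Lemma sum_set_split (i : X) (A : {set X} -> R) :
  \sum_S A S = \sum_(S : {set X} | i \notin S) (A S + A (i |: S)).
Proof.
rewrite big_split /= (bigID (fun S : {set X} => i \notin S)) /=; congr (_ + _).
rewrite (reindex_onto (fun S => i |: S) (fun S => S :\ i)) /=; last first.
  by move=> S; rewrite negbK => iS; rewrite finset.setD1K.
apply: eq_bigl => S; rewrite negbK setU11 /=.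
apply/eqP/idP => [<-|iS]; first by rewrite !inE eqxx.
by rewrite finset.setU1K.
Qed.

(** The extension is affine in each coordinate, so a partial derivative gives the difference
    exactly, for steps of any size and sign. *)
Lemma multilinear_step f x t i :
  multilinear f (x + t *: basis_vec i) =
  multilinear f x + t * multilinear (diff_set i f) x.
Proof.
pose P S := \prod_(j | j != i) (if j \in S then x j else 1 - x j).
have wE S y : (forall j, j != i -> y j = x j) ->
    weight S y = (if i \in S then y i else 1 - y i) * P S.
  by move=> yx; rewrite /weight (bigD1 i) //=; congr (_ * _); apply: eq_bigr => j /yx ->.
have PU S : P (i |: S) = P S.
  by apply: eq_bigr => j /negbTE ji; rewrite !inE ji.
have yx j : j != i -> (x + t *: basis_vec i) j = x j.
  by move=> /negbTE ji; rewrite add_stepE ji mulr0 addr0.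
rewrite !multilinearE !(sum_set_split i) mulr_sumr -big_split /=.
apply: eq_bigr => S iS; rewrite !(wE _ _ yx) !(wE _ x) // !PU add_stepE eqxx mulr1.
rewrite /diff_set setU11 (negbTE iS) finset.setUA finset.setUid finset.setU1K //
  (finset.setDidPl _); last first.
  by rewrite disjoint_sym disjoints1.
ring.
Qed.

Lemma weight_bound S x : in_box (-1) 2 x -> `|weight S x| <= 2 ^+ #|X|.
Proof.
move=> xb; rewrite normr_prod -prodr_const; apply: ler_prod => i _.
rewrite normr_ge0 /=; have /andP[x1 x2] := xb i.
by case: ifP => _; rewrite ler_norml; apply/andP; split; lra.
Qed.

Lemma weight_ge0 S x : in_box 0 1 x -> 0 <= weight S x.
Proof.
move=> xb; apply: prodr_ge0 => i _; have /andP[x1 x2] := xb i.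
by case: ifP => _; lra.
Qed.

Lemma weight_le1 S x : in_box 0 1 x -> weight S x <= 1.
Proof.
move=> xb; apply: prodr_ile1 => i _; have /andP[x1 x2] := xb i.
by case: ifP => _; apply/andP; split; lra.
Qed.

Lemma multilinear_ge0 f x : nonneg_setfun f -> in_box 0 1 x -> 0 <= multilinear f x.
Proof.
move=> f0 xb; rewrite multilinearE; apply: sumr_ge0 => S _.
by rewrite mulr_ge0 // weight_ge0.
Qed.

Lemma multilinear_le_sum f x : nonneg_setfun f -> in_box 0 1 x ->
  multilinear f x <= \sum_S f S.
Proof.
move=> f0 xb; rewrite multilinearE; apply: ler_sum => S _.
by rewrite ler_piMr // weight_le1.
Qed.

Lemma multilinear_bound f x : in_box (-1) 2 x ->
  `|multilinear f x| <= (\sum_S `|f S|) * 2 ^+ #|X|.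
Proof.
move=> xb; rewrite multilinearE mulr_suml; apply: (le_trans (ler_norm_sum _ _ _)).
by apply: ler_sum => S _; rewrite normrM ler_wpM2l // weight_bound.
Qed.

(** Coordinates are switched from [x] to [y] one at a time; the points [z] on the way mix both, and
    [c i] pays for switching coordinate [i]. *)
Lemma coord_path (u : {ffun X -> R} -> R) x y (c : X -> R) :
  (forall z i, (forall j, z j = x j \/ z j = y j) -> z i = x i ->
     u (z + (y i - x i) *: basis_vec i) - u z <= c i) ->
  u y - u x <= \sum_i c i.
Proof.
move=> uc; pose mix (s : seq X) : {ffun X -> R} := [ffun j => if j \in s then y j else x j].
suff H s : uniq s -> u (mix s) - u x <= \sum_(i <- s) c i.
  have := H _ (enum_uniq X); rewrite big_enum /=.
  by have -> : mix (enum X) = y by apply/ffunP => j; rewrite ffunE mem_enum.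
elim: s => [_|i s IH /= /andP[iNs us]].
  by rewrite big_nil; have -> : mix [::] = x by [apply/ffunP => j; rewrite ffunE]; rewrite subrr.
rewrite big_cons.
have -> : mix (i :: s) = mix s + (y i - x i) *: basis_vec i.
  apply/ffunP => j; rewrite add_stepE !ffunE inE.
  case: eqVneq => [->|_]; rewrite ?(negbTE iNs) /= ?mulr1 ?mulr0 ?addr0 //.
  by rewrite addrC subrK.
have h1 : u (mix s + (y i - x i) *: basis_vec i) - u (mix s) <= c i.
  apply: uc => [j|]; rewrite !ffunE ?(negbTE iNs) //.
  by case: ifP => _; [right|left].
have := IH us; lra.
Qed.

Lemma coord_path_le0 (u : {ffun X -> R} -> R) x y :
  (forall z i, (forall j, z j = x j \/ z j = y j) -> z i = x i ->
     u (z + (y i - x i) *: basis_vec i) - u z <= 0) ->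
  u y - u x <= 0.
Proof. by move=> /coord_path; rewrite big1_eq. Qed.

Definition l1norm x : R := \sum_i `|x i|.

Lemma in_box_mix a b x y z : in_box a b x -> in_box a b y ->
  (forall j, z j = x j \/ z j = y j) -> in_box a b z.
Proof. by move=> xb yb zE j; case: (zE j) => ->. Qed.

Lemma multilinear_lipschitz f (C : R) x y :
  (forall i z, in_box (-1) 2 z -> `|multilinear (diff_set i f) z| <= C) ->
  in_box (-1) 2 x -> in_box (-1) 2 y ->
  `|multilinear f y - multilinear f x| <= C * l1norm (y - x).
Proof.
move=> fC xb yb.
have stepb z i : (forall j, z j = x j \/ z j = y j) ->
    `|(y i - x i) * multilinear (diff_set i f) z| <= C * `|(y - x) i|.
  move=> /(in_box_mix xb yb)/fC zC; rewrite normrM mulrC !ffunE.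
  by rewrite ler_wpM2r.
rewrite /l1norm mulr_sumr ler_norml; apply/andP; split.
  rewrite lerNl; have := @coord_path (fun z => - multilinear f z) x y
    (fun i => C * `|(y - x) i|).
  rewrite opprB -[X in _ -> X <= _]/(_ - _) => H.
  have -> : multilinear f x - multilinear f y = - multilinear f y - - multilinear f x by ring.
  apply: H => z i zE _; rewrite multilinear_step opprD addrAC addrN add0r.
  by apply: le_trans (stepb z i zE); rewrite -normrN ler_norm.
apply: coord_path => z i zE _; rewrite multilinear_step addrAC addrN add0r.
by apply: le_trans (stepb z i zE); rewrite ler_norm.
Qed.

(** Here [u] is the extension minus its linear part at [x]. Switching coordinate [i] changes [u] by
    the step times the change of a partial derivative since [x], and that derivative is
    Lipschitz. *)
Lemma multilinear_taylor f (C : R) x y :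
  (forall i j z, in_box (-1) 2 z ->
     `|multilinear (diff_set j (diff_set i f)) z| <= C) ->
  in_box (-1) 2 x -> in_box (-1) 2 y ->
  `|multilinear f y - multilinear f x -
    \sum_i (y i - x i) * multilinear (diff_set i f) x| <= C * l1norm (y - x) ^+ 2.
Proof.
move=> fC xb yb.
pose lin (z : {ffun X -> R}) := \sum_i z i * multilinear (diff_set i f) x.
pose u z := multilinear f z - lin z.
have linS z t i : lin (z + t *: basis_vec i) = lin z + t * multilinear (diff_set i f) x.
  rewrite /lin (bigD1 i) // [in RHS](bigD1 i) //= add_stepE eqxx mulr1.
  rewrite mulrDl addrAC; congr (_ + _ + _); apply: eq_bigr => j /negbTE ji.
  by rewrite add_stepE ji mulr0 addr0.
have uE : multilinear f y - multilinear f x -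
    \sum_i (y i - x i) * multilinear (diff_set i f) x = u y - u x.
  rewrite /u /lin (eq_bigr _ (fun i _ => mulrBl _ _ _)) sumrB; ring.
have stepb z i : (forall j, z j = x j \/ z j = y j) ->
    `|u (z + (y i - x i) *: basis_vec i) - u z| <= C * l1norm (y - x) * `|(y - x) i|.
  move=> zE; rewrite /u linS multilinear_step.
  have -> : multilinear f z + (y i - x i) * multilinear (diff_set i f) z -
     (lin z + (y i - x i) * multilinear (diff_set i f) x) - (multilinear f z - lin z)
     = (y - x) i * (multilinear (diff_set i f) z - multilinear (diff_set i f) x).
    by rewrite !ffunE; ring.
  rewrite normrM mulrC ler_wpM2r //.
  apply: (le_trans (multilinear_lipschitz (fC i) xb (in_box_mix xb yb zE))).
  apply: ler_wpM2l; first by apply: le_trans (fC i i x xb).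
  apply: ler_sum => j _; rewrite !ffunE; case: (zE j) => -> //.
  by rewrite subrr normr0.
rewrite uE expr2 mulrA {2}/l1norm mulr_sumr ler_norml; apply/andP; split.
  rewrite lerNl.
  have -> : - (u y - u x) = - u y - - u x by ring.
  apply: (@coord_path (fun z => - u z)) => z i zE _.
  by have := stepb z i zE; rewrite ler_norml => /andP[h1 h2]; lra.
by apply: coord_path => z i zE _; apply: le_trans (stepb z i zE); rewrite ler_norm.
Qed.

(** For distinct [i] and [j] this is submodularity for two sets whose union and intersection are the
    other two corners of the square; for equal ones everything cancels. *)
Lemma diff_set_submod f i j S : submodular f -> diff_set j (diff_set i f) S <= 0.
Proof.
move=> fs; rewrite /diff_set; case: (eqVneq i j) => [<-|ij].
  have -> : i |: (i |: S) = i |: (S :\ i) by apply/setP => a; rewrite !inE; case: eqP.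
  have -> : (i |: S) :\ i = S :\ i :\ i by apply/setP => a; rewrite !inE; case: eqP.
  by rewrite subrr.
have := fs (i |: (S :\ j)) ((j |: S) :\ i).
have -> : (i |: (S :\ j)) :|: ((j |: S) :\ i) = i |: (j |: S).
  by apply/setP => a; rewrite !inE; case: (a == i); case: (a == j); case: (a \in S).
have -> : (i |: (S :\ j)) :&: ((j |: S) :\ i) = S :\ j :\ i.
  by apply/setP => a; rewrite !inE; case: (eqVneq a i) => [->|_] /=;
    rewrite ?(negbTE ij) //=; case: (a == j); case: (a \in S).
lra.
Qed.

Lemma multilinear_le0 f x : (forall S, f S <= 0) -> in_box 0 1 x -> multilinear f x <= 0.
Proof.
move=> f0 xb; rewrite multilinearE; apply: sumr_le0 => S _.
by rewrite mulr_le0_ge0 // weight_ge0.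
Qed.

Lemma multilinear_diff_antitone f i x y : submodular f ->
  in_box 0 1 x -> in_box 0 1 y -> (forall j, x j <= y j) ->
  multilinear (diff_set i f) y <= multilinear (diff_set i f) x.
Proof.
move=> fs xb yb xy; rewrite -subr_le0.
apply: coord_path_le0 => z j zE _; rewrite multilinear_step addrAC addrN add0r.
apply: mulr_ge0_le0; first by rewrite subr_ge0.
apply: multilinear_le0 (in_box_mix xb yb zE) => S.
exact: diff_set_submod.
Qed.

(** On the way from [x] to [x + a], each switched coordinate changes the gain from [b] by a
    nonnegative step times a difference of partial derivatives, and these are antitone. *)
Lemma multilinear_dr f x (a b : {ffun X -> R}) : submodular f ->
  (forall j, 0 <= a j) -> (forall j, 0 <= b j) ->
  in_box 0 1 x -> in_box 0 1 (x + a + b) ->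
  multilinear f (x + a + b) - multilinear f (x + a)
    - multilinear f (x + b) + multilinear f x <= 0.
Proof.
move=> fs a0 b0 xb yb.
have -> : multilinear f (x + a + b) - multilinear f (x + a)
    - multilinear f (x + b) + multilinear f x =
    (multilinear f (x + a + b) - multilinear f (x + a)) -
    (multilinear f (x + b) - multilinear f x) by ring.
apply: (@coord_path_le0 (fun z => multilinear f (z + b) - multilinear f z)) => z i zE _.
have -> : z + ((x + a) i - x i) *: basis_vec i + b
   = z + b + ((x + a) i - x i) *: basis_vec i by rewrite addrAC.
rewrite !multilinear_step.
set t := (x + a) i - x i.
have t0 : 0 <= t by rewrite /t !ffunE addrAC subrr add0r.
have zb : in_box 0 1 z /\ in_box 0 1 (z + b).
  by split=> j; have := xb j; have := yb j; rewrite !ffunE => ? ?;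
    have := a0 j; have := b0 j; case: (zE j) => ->; rewrite ?ffunE; lra.
have h j : z j <= (z + b) j by rewrite ffunE lerDl.
have := ler_wpM2l t0 (@multilinear_diff_antitone f i z (z + b) fs zb.1 zb.2 h).
lra.
Qed.

Lemma multilinear_homo f x (a : {ffun X -> R}) : monotone_setfun f ->
  (forall j, 0 <= a j) -> in_box 0 1 x -> in_box 0 1 (x + a) ->
  multilinear f x <= multilinear f (x + a).
Proof.
move=> fm a0 xb yb; rewrite -lerN2 -subr_le0.
apply: (@coord_path_le0 (fun z => - multilinear f z)) => z i zE _.
rewrite multilinear_step.
have -> : (x + a) i - x i = a i by rewrite ffunE addrAC subrr add0r.
rewrite opprD opprK addrAC addNr add0r oppr_le0.
apply: mulr_ge0 => //; apply: multilinear_ge0 (in_box_mix xb yb zE) => S.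
by rewrite /diff_set subr_ge0 fm // (fintype.subset_trans (finset.subD1set _ _)) // finset.subsetU1.
Qed.

Lemma weight_perm (s : {perm X}) S x : weight (s @: S) (permute s x) = weight S x.
Proof.
rewrite /weight (reindex_inj (@perm_inj _ s)) /=; apply: eq_bigr => i _.
by rewrite (mem_imset _ _ (@perm_inj _ s)) ffunE permK.
Qed.

Lemma multilinear_perm f (s : {perm X}) x :
  multilinear f (permute s x) = multilinear (fun S => f (s @: S)) x.
Proof.
rewrite !multilinearE (reindex_inj (imset_inj (@perm_inj _ s))) /=.
by apply: eq_bigr => S _; rewrite weight_perm.
Qed.

Lemma diff_set_perm f (s : {perm X}) i S :
  diff_set (s i) f (s @: S) = diff_set i (fun U => f (s @: U)) S.
Proof.
rewrite /diff_set; congr (f _ - f _); apply/setP => a; rewrite -(permKV s a) !inE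
  !(mem_imset _ _ (@perm_inj _ s)) !inE (inj_eq (@perm_inj _ s)) //.
Qed.

(** * Averaging over a group of permutations *)

Section Symmetrization.
Variable G : {group {perm X}}.

Lemma card_group_gt0 : 0 < #|G|%:R :> R.
Proof. by rewrite ltr0n cardG_gt0. Qed.

Lemma symmetrizeE x j :
  symmetrize G x j = (#|G|%:R)^-1 * \sum_(s in G) x (s j).
Proof.
rewrite /symmetrize ffunE sum_ffunE; congr (_ * _).
rewrite (reindex_inj invg_inj) /=; apply: eq_big => s; first by rewrite groupV.
by rewrite ffunE invgK.
Qed.

Lemma symmetrizeD x y : symmetrize G (x + y) = symmetrize G x + symmetrize G y.
Proof.
apply/ffunP => j; rewrite [RHS]ffunE !symmetrizeE -mulrDr -big_split /=.
by congr (_ * _); apply: eq_bigr => s _; rewrite ffunE.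
Qed.

Lemma symmetrizeZ t x : symmetrize G (t *: x) = t *: symmetrize G x.
Proof.
apply/ffunP => j; rewrite [RHS]ffunE -[RHS]/(t * symmetrize G x j) !symmetrizeE mulrCA.
congr (_ * _); rewrite mulr_sumr.
by apply: eq_bigr => s _; rewrite ffunE.
Qed.

Lemma symmetrizeN x : symmetrize G (- x) = - symmetrize G x.
Proof.
apply/ffunP => j; rewrite [RHS]ffunE !symmetrizeE -mulrN -sumrN.
by congr (_ * _); apply: eq_bigr => s _; rewrite ffunE.
Qed.

Lemma symmetrize_inv x s j : s \in G -> symmetrize G x (s j) = symmetrize G x j.
Proof.
move=> sG; rewrite !symmetrizeE; congr (_ * _).
rewrite (reindex_inj (mulgI s^-1%g)) /=; apply: eq_big => t.
  by rewrite groupMl ?groupV.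
by rewrite permM permK.
Qed.

Lemma symmetrize_fixed x : (forall s j, s \in G -> x (s j) = x j) ->
  symmetrize G x = x.
Proof.
move=> xs; apply/ffunP => j; rewrite symmetrizeE.
rewrite (eq_bigr (fun=> x j)) => [|s sG]; last exact: xs.
rewrite sumr_const -(mulr_natl (x j)) mulrA mulVf ?mul1r //.
by rewrite gt_eqF // card_group_gt0.
Qed.

Lemma symmetrizeK x : symmetrize G (symmetrize G x) = symmetrize G x.
Proof. by apply: symmetrize_fixed => s j; apply: symmetrize_inv. Qed.

Lemma symmetrize_sum x : \sum_j symmetrize G x j = \sum_j x j.
Proof.
under eq_bigr do rewrite symmetrizeE.
rewrite -mulr_sumr exchange_big /= (eq_bigr (fun=> \sum_j x j)) => [|s sG].
  rewrite sumr_const -(mulr_natl (\sum_j x j)) mulrA mulVf ?mul1r //.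
  by rewrite gt_eqF // card_group_gt0.
by rewrite [RHS](reindex_inj (@perm_inj _ s)).
Qed.

Lemma symmetrize_in_box a b x : in_box a b x -> in_box a b (symmetrize G x).
Proof.
move=> xb j; rewrite symmetrizeE mulrC ler_pdivlMr ?ler_pdivrMr ?card_group_gt0 //.
rewrite -!sum1_card !natr_sum !mulr_sumr !mulr1.
by apply/andP; split; apply: ler_sum => s _; case/andP: (xb (s j)).
Qed.

(** The Taylor expansion at the symmetrized point has no linear term: the gradient there is
    invariant under [G], whereas the displacement averages to 0 over [G]. *)
Lemma multilinear_symmetrize f (C : R) x :
  (forall S s, s \in G -> f S = f (s @: S)) ->
  (forall i j z, in_box (-1) 2 z ->
     `|multilinear (diff_set j (diff_set i f)) z| <= C) ->
  in_box (-1) 2 x ->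
  `|multilinear f x - multilinear f (symmetrize G x)|
    <= C * l1norm (x - symmetrize G x) ^+ 2.
Proof.
move=> fG fC xb; set p := symmetrize G x.
have pb : in_box (-1) 2 p by exact: symmetrize_in_box.
have := multilinear_taylor fC pb xb.
suff -> : \sum_i (x i - p i) * multilinear (diff_set i f) p = 0 by rewrite subr0.
pose g i := multilinear (diff_set i f) p; rewrite -/g.
have gG s i : s \in G -> g (s i) = g i.
  move=> sG; rewrite /g.
  have pE : p = permute s p.
    by apply/ffunP => j; rewrite [RHS]ffunE /p symmetrize_inv // groupV.
  rewrite {1}pE multilinear_perm !multilinearE; apply: eq_bigr => S _.
  rewrite diff_set_perm; congr (_ * _); rewrite /diff_set.
  by rewrite -!(fG _ s sG).
pose v := x - p.
have v0 i : \sum_(s in G) v (s i) = 0.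
  have : symmetrize G v i = 0.
    by rewrite symmetrizeD symmetrizeN symmetrizeK subrr ffunE.
  rewrite symmetrizeE => /eqP; rewrite mulf_eq0 invr_eq0 gt_eqF ?card_group_gt0 //=.
  by move=> /eqP.
(* The linear term keeps its value when [v] is permuted, so it equals its average over [G], which
   vanishes by [v0]. *)
have sumE s : s \in G -> \sum_i (x i - p i) * g i = \sum_i v (s i) * g i.
  move=> sG; rewrite (reindex_inj (@perm_inj _ s)) /=; apply: eq_bigr => i _.
  by rewrite gG // !ffunE.
have : \sum_(s in G) \sum_i (x i - p i) * g i = 0.
  rewrite (eq_bigr _ sumE) exchange_big /= big1 // => i _.
  by rewrite -mulr_suml v0 mul0r.
rewrite sumr_const => /eqP; rewrite mulrn_eq0 -leqn0 leqNgt cardG_gt0 /=.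
by move=> /eqP.
Qed.

End Symmetrization.
End Multilinear.

(** * A slowly varying cutoff *)

Section Cutoff.
Variable R : realType.
Implicit Types a b c d p q s t : R.

Definition pos_sqr t : R := if 0 <= t then t ^+ 2 else 0.

Lemma pos_sqr_ge t : 0 <= t -> pos_sqr t = t ^+ 2.
Proof. by rewrite /pos_sqr => ->. Qed.

Lemma pos_sqr_le t : t <= 0 -> pos_sqr t = 0.
Proof.
rewrite /pos_sqr => t0; case: ifP => // t1.
by have -> : t = 0 by [lra]; rewrite expr0n.
Qed.

(** The second derivative of [pos_sqr] takes only the values 0 and 2; the cases are which of the
    four arguments are positive. *)
Lemma pos_sqr_diff2 a p q : 0 <= p -> 0 <= q ->
  0 <= pos_sqr (a + p + q) - pos_sqr (a + p) - pos_sqr (a + q) + pos_sqr a <= 2 * (p * q).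
Proof.
move=> p0 q0; have pq := mulr_ge0 p0 q0.
have [a0|a0] := leP 0 a.
  by rewrite !pos_sqr_ge; [apply/andP; split; nra|lra|lra|lra|lra].
rewrite (pos_sqr_le (ltW a0)).
have [s0|s0] := leP (a + p + q) 0.
  by rewrite !pos_sqr_le; [apply/andP; split; lra|lra|lra|lra].
rewrite (pos_sqr_ge (ltW s0)).
have [ap|ap] := leP (a + p) 0; have [aq|aq] := leP (a + q) 0.
- rewrite !pos_sqr_le //; apply/andP; split; first nra.
  have h1 : a + p + q <= p by lra.
  have h2 : a + p + q <= q by lra.
  have := ler_pM (ltW s0) (ltW s0) h1 h2; rewrite -expr2; lra.
- rewrite (pos_sqr_le ap) (pos_sqr_ge (ltW aq)); apply/andP; split; nra.
- rewrite (pos_sqr_le aq) (pos_sqr_ge (ltW ap)); apply/andP; split; nra.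
- rewrite (pos_sqr_ge (ltW aq)) (pos_sqr_ge (ltW ap)).
  have h : (- a) * (- a) <= p * q by apply: ler_pM; lra.
  apply/andP; split; nra.
Qed.

(* A quadratic spline equal to 1 up to 1 and to 0 from 2 on. *)
Definition bump t : R :=
  1 - 2 * pos_sqr (t - 1) + 4 * pos_sqr (t - 3 / 2) - 2 * pos_sqr (t - 2).

Lemma bump_le1 t : t <= 1 -> bump t = 1.
Proof. by move=> t1; rewrite /bump !pos_sqr_le; lra. Qed.

Lemma bump_ge2 t : 2 <= t -> bump t = 0.
Proof. by move=> t1; rewrite /bump !pos_sqr_ge; [field|lra|lra|lra]. Qed.

Lemma bump_range t : 0 <= bump t <= 1.
Proof.
have [t1|t1] := leP t 1; first by rewrite bump_le1 //; lra.
have [t2|t2] := leP 2 t; first by rewrite bump_ge2 //; lra.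
rewrite /bump pos_sqr_ge ?(@pos_sqr_le (t - 2)); [|lra|lra].
have [t3|t3] := leP t (3 / 2).
  by rewrite pos_sqr_le; [apply/andP; split; nra|lra].
by rewrite pos_sqr_ge; [apply/andP; split; nra|lra].
Qed.

(** Each spline contributes between 0 and [2 * (p * q)]; the coefficients -2, 4, -2 turn this into
    the constant 8. *)
Lemma bump_diff2_ge0 a p q : 0 <= p -> 0 <= q ->
  `|bump (a + p + q) - bump (a + p) - bump (a + q) + bump a| <= 8 * (p * q).
Proof.
move=> p0 q0; rewrite /bump.
have sh (u : R) :
  [/\ a + p + q - u = (a - u) + p + q, a + p - u = (a - u) + p & a + q - u = (a - u) + q].
  by split; ring.
have [-> -> ->] := sh 1; have [-> -> ->] := sh (3 / 2); have [-> -> ->] := sh 2.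
have := pos_sqr_diff2 (a - 1) p0 q0; have := pos_sqr_diff2 (a - 3 / 2) p0 q0.
have := pos_sqr_diff2 (a - 2) p0 q0.
move=> /andP[? ?] /andP[? ?] /andP[? ?]; rewrite ler_norml; apply/andP; split; lra.
Qed.

(** For a negative step, another corner of the rectangle serves as base point, which changes at most
    the sign. *)
Lemma bump_diff2 a p q :
  `|bump (a + p + q) - bump (a + p) - bump (a + q) + bump a| <= 8 * (`|p| * `|q|).
Proof.
have [p0|p0] := leP 0 p; have [q0|q0] := leP 0 q.
- by rewrite (ger0_norm p0) (ger0_norm q0); exact: bump_diff2_ge0.
- have := @bump_diff2_ge0 (a + q) p (- q) p0; rewrite oppr_ge0 => /(_ (ltW q0)).
  have -> : a + q + p + - q = a + p by ring.
  have -> : a + q + p = a + p + q by ring.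
  have -> : a + q + - q = a by ring.
  by rewrite -normrN (ger0_norm p0) (ltr0_norm q0); congr (`|_| <= _); ring.
- have := @bump_diff2_ge0 (a + p) (- p) q; rewrite oppr_ge0 => /(_ (ltW p0) q0).
  have -> : a + p + - p + q = a + q by ring.
  have -> : a + p + - p = a by ring.
  by rewrite -normrN (ger0_norm q0) (ltr0_norm p0); congr (`|_| <= _); ring.
- have := @bump_diff2_ge0 (a + p + q) (- p) (- q).
  rewrite !oppr_ge0 => /(_ (ltW p0) (ltW q0)).
  have -> : a + p + q + - p + - q = a by ring.
  have -> : a + p + q + - p = a + q by ring.
  have -> : a + p + q + - q = a + p by ring.
  by rewrite (ltr0_norm q0) (ltr0_norm p0); congr (`|_| <= _); ring.
Qed.

Lemma bump_lip_le a b : a <= b -> `|bump b - bump a| <= 8 * (b - a).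
Proof.
have H x y : x <= y -> y <= 2 -> `|bump y - bump x| <= 8 * (y - x).
  (* This second difference is in fact a first difference: two of its corners are at most 1, where
     [bump] is 1. *)
  move=> xy y2; have := bump_diff2 (x - 1) (y - x) 1.
  have -> : x - 1 + (y - x) + 1 = y by ring.
  rewrite subrK normr1 mulr1 (@bump_le1 (x - 1)); last lra.
  rewrite (@bump_le1 (x - 1 + _)); last lra.
  by rewrite (ger0_norm (x := y - x)); [congr (`|_| <= _); ring|lra].
move=> ab; have [b2|b2] := leP b 2; first exact: H.
have [a2|a2] := leP 2 a.
  by rewrite !bump_ge2 ?subrr ?normr0; lra.
have := H _ _ (ltW a2) (lexx 2); rewrite (bump_ge2 (lexx 2)) (bump_ge2 (ltW b2)); lra.
Qed.

Lemma bump_lip a b : `|bump b - bump a| <= 8 * `|b - a|.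
Proof.
have [ab|ab] := leP a b.
  by rewrite (ger0_norm (x := b - a)); [apply: bump_lip_le|lra].
rewrite distrC [in leRHS]distrC (ger0_norm (x := a - b)); last lra.
by apply: bump_lip_le; exact: ltW.
Qed.

Variables (delta : R) (K : nat).
Hypotheses (delta_gt0 : 0 < delta) (K_gt0 : (0 < K)%N).

(* Averaging over K geometric scales makes t * phi'(t) and t^2 * phi''(t) of
   order 1/K, since at each t at most one scale is in transition. *)
Definition cutoff t : R :=
  (K%:R)^-1 * \sum_(m < K) bump (t / (delta * 16 ^+ m)).

Let scale_gt0 (m : nat) : 0 < delta * 16 ^+ m.
Proof. by rewrite mulr_gt0 // exprn_gt0. Qed.

Let Kinv_gt0 : 0 < (K%:R)^-1 :> R.
Proof. by rewrite invr_gt0 ltr0n. Qed.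

Lemma cutoff_range t : 0 <= cutoff t <= 1.
Proof.
rewrite /cutoff mulrC ler_pdivlMr ?ler_pdivrMr ?ltr0n // mul0r mul1r.
apply/andP; split.
  by apply: sumr_ge0 => m _; case/andP: (bump_range (t / (delta * 16 ^+ m))).
have -> : K%:R = \sum_(m < K) 1 :> R by rewrite sumr_const card_ord.
by apply: ler_sum => m _; case/andP: (bump_range (t / (delta * 16 ^+ m))).
Qed.

Lemma cutoff_le t : t <= delta -> cutoff t = 1.
Proof.
move=> td; rewrite /cutoff (eq_bigr (fun=> 1)) => [|m _].
  by rewrite sumr_const card_ord mulVf // pnatr_eq0 -lt0n.
rewrite bump_le1 // ler_pdivrMr // mul1r (le_trans td) //.
have h : 1 <= 16 ^+ m :> R by rewrite exprn_ege1 // ler1n.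
have := ler_wpM2l (ltW delta_gt0) h; lra.
Qed.

Lemma cutoff_ge t : 2 * (delta * 16 ^+ K.-1) <= t -> cutoff t = 0.
Proof.
move=> td; rewrite /cutoff big1 ?mulr0 // => m _.
rewrite bump_ge2 // ler_pdivlMr //; apply: le_trans td.
have h : 16 ^+ m <= 16 ^+ K.-1 :> R.
  by rewrite ler_eXn2l ?ltr1n // -ltnS prednK.
have := ler_wpM2l (ltW delta_gt0) h; lra.
Qed.

(* [E] stands for a first or second difference of [bump (x / s)] taken at
   points [x] in [[t/2, 2t]]. *)
Lemma cutoff_transition t (E : R -> R) (B : R) : 0 < t ->
  (forall s, 0 < s -> s < t / 4 \/ 2 * t < s -> E s = 0) ->
  (forall s, 0 < s -> `|E s| <= B) ->
  `|(K%:R)^-1 * \sum_(m < K) E (delta * 16 ^+ m)| <= (K%:R)^-1 * B.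
Proof.
move=> t0 E0 EB; rewrite normrM gtr0_norm //; apply: ler_wpM2l; first exact: ltW.
have B0 : 0 <= B by apply: le_trans (EB 1 ltr01).
pose act (m : 'I_K) := t / 4 <= delta * 16 ^+ m <= 2 * t.
have nact m : ~~ act m -> E (delta * 16 ^+ m) = 0.
  by rewrite negb_and -!ltNge => /orP sm; apply: E0.
case: (pickP act) => [m am|nam]; last first.
  by rewrite big1 ?normr0 // => m _; rewrite nact // nam.
rewrite (bigD1 m) //= big1 ?addr0 => [|m' m'm]; first exact: EB.
apply: nact; apply/negP => am'.
(* Active scales differ by a factor of at most 8, while consecutive scales differ by 16. *)
have lt (i j : 'I_K) : act i -> act j -> ~~ (i < j)%N.
  move=> /andP[i1 i2] /andP[j1 j2]; apply/negP => ij.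
  have : (16 : R) ^+ i.+1 <= 16 ^+ j by rewrite ler_eXn2l ?ltr1n.
  rewrite exprS => h; have := ler_wpM2l (ltW delta_gt0) h; lra.
have := lt _ _ am am'; have := lt _ _ am' am.
by rewrite -!leqNgt => h1 h2; case/negP: m'm; apply/eqP/val_inj/anti_leq; rewrite h1 h2.
Qed.

Let mid t s := t / 2 <= s <= 2 * t.

Let bump_inactive t s x y : 0 < s -> s < t / 4 \/ 2 * t < s ->
  mid t x -> mid t y -> bump (x / s) = bump (y / s).
Proof.
rewrite /mid => s0 st /andP[x1 x2] /andP[y1 y2].
case: st => st; first by rewrite !bump_ge2 // ler_pdivlMr //; lra.
by rewrite !bump_le1 // ler_pdivrMr //; lra.
Qed.

Let inv_le t s : 0 < t -> t / 4 <= s -> s^-1 <= 4 / t.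
Proof.
by move=> t0 ts; rewrite -[leRHS]invf_div lef_pV2 // posrE; lra.
Qed.

Lemma cutoff_lip t a b : 0 < t -> mid t a -> mid t b ->
  `|cutoff b - cutoff a| <= (K%:R)^-1 * (32 * (`|b - a| / t)).
Proof.
move=> t0 ma mb; rewrite /cutoff -mulrBr -sumrB.
have B0 : 0 <= 32 * (`|b - a| / t) by rewrite mulr_ge0 // divr_ge0 // ltW.
apply: (@cutoff_transition t (fun s => bump (b / s) - bump (a / s))) => // s s0.
  by move=> st; rewrite (bump_inactive s0 st ma mb) subrr.
have [st|st] := ltP s (t / 4).
  by rewrite (bump_inactive s0 _ ma mb) ?subrr ?normr0 //; left.
apply: (le_trans (bump_lip _ _)); rewrite -mulrBl normrM (gtr0_norm (x := s^-1)) ?invr_gt0 //.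
have := ler_wpM2l (normr_ge0 (b - a)) (inv_le t0 st); lra.
Qed.

(** The point [b + c - a] completes a parallelogram. Its distance to [d] is charged to the Lipschitz
    bound, the rest to the second difference of [bump]; 32 and 128 are 8 times 4 and 8 times 16, as
    an active scale is at least [t / 4]. *)
Lemma cutoff_diff2 t a b c d : 0 < t -> mid t a -> mid t b -> mid t c -> mid t d ->
  `|cutoff d - cutoff b - cutoff c + cutoff a| <=
  (K%:R)^-1 * (32 * (`|d - b - c + a| / t) + 128 * (`|b - a| * `|c - a| / t ^+ 2)).
Proof.
move=> t0 ma mb mc md.
have -> : cutoff d - cutoff b - cutoff c + cutoff a = (K%:R)^-1 * \sum_(m < K)
   (fun s => bump (d / s) - bump (b / s) - bump (c / s) + bump (a / s)) (delta * 16 ^+ m).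
  by rewrite /cutoff -!mulrBr -mulrDr -!sumrB -big_split.
have B1 : 0 <= `|d - b - c + a| / t by rewrite divr_ge0 // ltW.
have B2 : 0 <= `|b - a| * `|c - a| / t ^+ 2.
  by apply: divr_ge0; [exact: mulr_ge0|exact: sqr_ge0].
have Einact s : 0 < s -> s < t / 4 \/ 2 * t < s ->
    bump (d / s) - bump (b / s) - bump (c / s) + bump (a / s) = 0.
  move=> s0 st; rewrite (bump_inactive s0 st md ma) (bump_inactive s0 st mb ma).
  by rewrite (bump_inactive s0 st mc ma); ring.
apply: (@cutoff_transition t (fun s =>
  bump (d / s) - bump (b / s) - bump (c / s) + bump (a / s))) => // s s0.
have [st|st] := ltP s (t / 4).
  by rewrite Einact //; [rewrite normr0; apply: addr_ge0; exact: mulr_ge0 | left].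
have h1 := bump_lip ((b + c - a) / s) (d / s).
have h2 := bump_diff2 (a / s) ((b - a) / s) ((c - a) / s).
have si := inv_le t0 st; have s'0 : 0 < s^-1 by rewrite invr_gt0.
rewrite -!mulrDl in h2.
have E1 : a + (b - a) + (c - a) = b + c - a by ring.
have E2 : a + (b - a) = b by ring.
have E3 : a + (c - a) = c by ring.
rewrite E1 E2 E3 in h2.
have -> : bump (d / s) - bump (b / s) - bump (c / s) + bump (a / s) =
  (bump (d / s) - bump ((b + c - a) / s)) +
  (bump ((b + c - a) / s) - bump (b / s) - bump (c / s) + bump (a / s)) by ring.
apply: (le_trans (ler_normD _ _)); apply: lerD.
  apply: (le_trans h1); rewrite -mulrBl normrM (gtr0_norm s'0).
  have -> : d - (b + c - a) = d - b - c + a by ring.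
  have := ler_wpM2l (normr_ge0 (d - b - c + a)) si; lra.
apply: (le_trans h2); rewrite !normrM (gtr0_norm s'0).
have h3 : s^-1 * s^-1 <= (4 / t) * (4 / t) by apply: ler_pM => //; exact: ltW.
have h4 : (4 / t) * (4 / t) = 16 / t ^+ 2 by field; lra.
rewrite h4 in h3.
have h5 : 0 <= `|b - a| * `|c - a| by rewrite mulr_ge0.
have := ler_wpM2l h5 h3; lra.
Qed.

End Cutoff.

(** * Smoothing *)

Section Arithmetic.
Variable R : realFieldType.
Implicit Types (C D L c delta h k l m t : R).

(** In the applications [h] is the step, [k] the size of [X], [l] the l1 norm of x - bar x, [D] its
    squared Euclidean norm, [L] is [l + h], [c] is 1/K and [m] is 2k + 2. The aim here is that one
    step changes [D] by at most [delta / 4]. *)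
Lemma step_small h l k delta : 0 <= h <= 1 -> 0 <= k -> l <= k ->
  h * (4 * k + 8) <= delta / 4 -> 2 * h * (l + h) <= delta / 4.
Proof.
move=> /andP[h0 h1] k0 lk hd; have := ler_wpM2l h0 lk; have := ler_wpM2l h0 h1.
have := mulr_ge0 h0 k0; lra.
Qed.

Lemma step2_small h l l' k delta : 0 <= h <= 1 -> l <= k -> l' <= l + 2 * h ->
  h * (4 * k + 8) <= delta / 4 ->
  (2 * h * l' + 2 * h ^+ 2) + (2 * h * l + 2 * h ^+ 2) <= delta / 4.
Proof.
move=> /andP[h0 h1] lk ll' hd.
have := ler_wpM2l h0 lk; have := ler_wpM2l h0 h1; have := ler_wpM2l h0 ll'.
rewrite expr2; lra.
Qed.

Lemma near_large t D delta : 0 < delta -> `|t - D| <= delta / 4 -> delta / 2 <= D ->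
  D / 2 <= t <= 2 * D.
Proof. by move=> d0; rewrite ler_norml => /andP[? ?] ?; apply/andP; split; lra. Qed.

Lemma near_small t D delta : 0 < delta -> `|t - D| <= delta / 4 -> D < delta / 2 ->
  t <= delta.
Proof. by move=> d0; rewrite ler_norml => /andP[? ?] ?; lra. Qed.

Lemma first_order_rescale (a D L h : R) :
  a <= 2 * h * L / D -> 32 * a <= 64 * (h * L / D).
Proof. lra. Qed.

Lemma second_order_rescale (a b D L h : R) :
  a <= 4 * h ^+ 2 / D -> b <= 2 * h * L * (2 * h * L) / D ^+ 2 ->
  32 * a + 128 * b <= 128 * (h ^+ 2 / D) + 512 * (h ^+ 2 * L ^+ 2 / D ^+ 2).
Proof.
have -> : 2 * h * L * (2 * h * L) / D ^+ 2 = 4 * (h ^+ 2 * L ^+ 2 / D ^+ 2).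
  by rewrite !expr2; ring.
lra.
Qed.

(** Uses that (l + h)^2 is at most 2 l^2 + 2 h^2, and that h^2 is at most [D] by the smallness of
    [h]. *)
Lemma sum_sq_small h l k D delta : 0 <= h <= 1 -> 0 <= k ->
  h * (4 * k + 8) <= delta / 4 -> 0 < delta -> delta / 2 <= D ->
  l ^+ 2 <= k * D -> (l + h) ^+ 2 <= (2 * k + 2) * D.
Proof.
move=> /andP[h0 h1] k0 hd d0 dD lD.
have hk := mulr_ge0 h0 k0; have hh := ler_wpM2l h0 h1.
have := sqr_ge0 (l - h); rewrite !expr2 in lD *; lra.
Qed.

Lemma cross_term_bound c C D L h m : 0 <= c -> 0 <= C -> 0 < D -> L ^+ 2 <= m * D ->
  c * (64 * (h * L / D)) * (C * (6 * (h * L))) <= c * C * h ^+ 2 * (384 * m).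
Proof.
move=> c0 C0 D0 LD; have qm : L ^+ 2 / D <= m by rewrite ler_pdivrMr.
have -> : c * (64 * (h * L / D)) * (C * (6 * (h * L))) =
    c * C * h ^+ 2 * (384 * (L ^+ 2 / D)) by field; lra.
apply: ler_wpM2l; last lra.
by apply: mulr_ge0; [exact: mulr_ge0|exact: sqr_ge0].
Qed.

Lemma main_term_bound c C D L h m : 0 <= c -> 0 <= C -> 0 < D -> L ^+ 2 <= m * D ->
  c * (128 * (h ^+ 2 / D) + 512 * (h ^+ 2 * L ^+ 2 / D ^+ 2)) * (C * (16 * L ^+ 2)) <=
  c * C * h ^+ 2 * (128 * 16 * m + 512 * 16 * m ^+ 2).
Proof.
move=> c0 C0 D0 LD; have qm : L ^+ 2 / D <= m by rewrite ler_pdivrMr.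
have q0 : 0 <= L ^+ 2 / D by rewrite divr_ge0 ?sqr_ge0 // ltW.
have qq := ler_pM q0 q0 qm qm.
have -> : c * (128 * (h ^+ 2 / D) + 512 * (h ^+ 2 * L ^+ 2 / D ^+ 2)) *
      (C * (16 * L ^+ 2)) =
    c * C * h ^+ 2 * (128 * 16 * (L ^+ 2 / D) + 512 * 16 * (L ^+ 2 / D * (L ^+ 2 / D))).
  by field; lra.
rewrite -expr2 in qq; apply: ler_wpM2l; last by rewrite expr2 in qq *; lra.
by apply: mulr_ge0; [exact: mulr_ge0|exact: sqr_ge0].
Qed.

(** The left side collects the two cross terms and the main term of the product rule; the right side
    is what the damping provides, and fixes [damping_coef]. *)
Lemma error_terms_bound c C h m : 0 <= c -> 0 <= C -> 2 <= m ->
  c * C * h ^+ 2 * (384 * m) + c * C * h ^+ 2 * (384 * m) +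
  c * C * h ^+ 2 * (128 * 16 * m + 512 * 16 * m ^+ 2) <=
  c * (128 * 128 * C * m ^+ 2) * (2 * h ^+ 2).
Proof.
move=> c0 C0 m2.
have A0 : 0 <= c * C * h ^+ 2 by apply: mulr_ge0; [exact: mulr_ge0|exact: sqr_ge0].
have mm : m <= m ^+ 2 by rewrite expr2; have := ler_wpM2l (le_trans _ m2) m2; nra.
set A := c * C * h ^+ 2 in A0 *.
have -> : c * (128 * 128 * C * m ^+ 2) * (2 * h ^+ 2) = A * (2 * 128 * 128 * m ^+ 2).
  by rewrite /A; ring.
rewrite -!mulrDr; apply: ler_wpM2l => //; lra.
Qed.

Lemma monotone_term_bound c C D L h m : 0 <= c -> 0 <= C -> 0 < D -> 0 <= h ->
  0 <= L <= m -> L ^+ 2 <= m * D ->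
  c * (64 * (h * L / D)) * (C * (4 * L ^+ 2)) <= c * (128 * 128 * C * m ^+ 2) * h.
Proof.
move=> c0 C0 D0 h0 /andP[L0 Lm] LD; have qm : L ^+ 2 / D <= m by rewrite ler_pdivrMr.
have q0 : 0 <= L ^+ 2 / D by rewrite divr_ge0 ?sqr_ge0 // ltW.
have qq := ler_pM q0 L0 qm Lm.
have A0 : 0 <= c * C * h by apply: mulr_ge0 => //; exact: mulr_ge0.
have -> : c * (64 * (h * L / D)) * (C * (4 * L ^+ 2)) =
  c * C * h * (256 * (L ^+ 2 / D * L)) by field; lra.
have -> : c * (128 * 128 * C * m ^+ 2) * h = c * C * h * (128 * 128 * (m * m)) by ring.
apply: ler_wpM2l => //.
have := mulr_ge0 q0 L0; lra.
Qed.

Lemma mixed_step_small h l l' : 0 <= h -> 0 <= l -> l' <= l + 2 * h ->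
  h * l' + 4 * h ^+ 2 <= 6 * (h * (l + h)).
Proof.
move=> h0 l0 ll; have := ler_wpM2l h0 ll; have := mulr_ge0 h0 l0; rewrite expr2; lra.
Qed.

Lemma two_steps_small h l : 0 <= l -> l + 2 * h + 2 * h <= 4 * (l + h).
Proof. lra. Qed.

Lemma add_damping_diff2 (g0 g1 g2 g3 j0 j1 j2 j3 b h : R) :
  g3 - g1 - g2 + g0 <= 0 -> j3 - j1 - j2 + j0 = - 2 * h ^+ 2 -> 0 <= b ->
  (g3 + b * j3) - (g1 + b * j1) - (g2 + b * j2) + (g0 + b * j0) <= 0.
Proof.
move=> g0' jE b0; have := mulr_ge0 b0 (sqr_ge0 h).
have -> : (g3 + b * j3) - (g1 + b * j1) - (g2 + b * j2) + (g0 + b * j0) =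
  (g3 - g1 - g2 + g0) + b * (j3 - j1 - j2 + j0) by ring.
rewrite jE; lra.
Qed.

(** Discrete product rule on the corners x, x + h e_i, x + h e_j and x + h e_i + h e_j, numbered 0
    to 3; the letters f, g, p, j stand for F(x), F(bar x), the cutoff and the damping. Besides a
    convex combination of two nonpositive differences there are three products, which the damping
    absorbs. *)
Lemma leibniz_diff2 (f0 f1 f2 f3 g0 g1 g2 g3 p0 p1 p2 p3 j0 j1 j2 j3 b a a' c' d' h : R) :
  0 <= p0 <= 1 -> f3 - f1 - f2 + f0 <= 0 -> g3 - g1 - g2 + g0 <= 0 ->
  j3 - j1 - j2 + j0 = - 2 * h ^+ 2 ->
  `|p1 - p0| <= a -> `|p2 - p0| <= a ->
  `|(f3 - g3) - (f1 - g1)| <= a' -> `|(f3 - g3) - (f2 - g2)| <= a' ->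
  `|p3 - p1 - p2 + p0| <= c' -> `|f3 - g3| <= d' ->
  a * a' + a * a' + c' * d' <= b * (2 * h ^+ 2) ->
  (f3 - p3 * (f3 - g3) + b * j3) - (f1 - p1 * (f1 - g1) + b * j1)
  - (f2 - p2 * (f2 - g2) + b * j2) + (f0 - p0 * (f0 - g0) + b * j0) <= 0.
Proof.
move=> /andP[p00 p01] f0' g0' jE p1a p2a h1 h2 pc hd sm.
have -> : (f3 - p3 * (f3 - g3) + b * j3) - (f1 - p1 * (f1 - g1) + b * j1)
  - (f2 - p2 * (f2 - g2) + b * j2) + (f0 - p0 * (f0 - g0) + b * j0) =
  (1 - p0) * (f3 - f1 - f2 + f0) + p0 * (g3 - g1 - g2 + g0)
  - (p1 - p0) * ((f3 - g3) - (f1 - g1)) - (p2 - p0) * ((f3 - g3) - (f2 - g2))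
  - (p3 - p1 - p2 + p0) * (f3 - g3) + b * (j3 - j1 - j2 + j0) by ring.
rewrite jE.
have t1 : (1 - p0) * (f3 - f1 - f2 + f0) <= 0 by apply: mulr_ge0_le0; lra.
have t2 : p0 * (g3 - g1 - g2 + g0) <= 0 by apply: mulr_ge0_le0.
have norm (x y u v : R) : `|x| <= u -> `|y| <= v -> - (x * y) <= u * v.
  move=> xu yv; apply: le_trans (ler_norm _) _; rewrite normrN normrM.
  exact: ler_pM.
have := norm _ _ _ _ p1a h1; have := norm _ _ _ _ p2a h2; have := norm _ _ _ _ pc hd.
lra.
Qed.

Lemma leibniz_diff1 (f0 f1 g0 g1 p0 p1 j0 j1 b a d' h : R) :
  0 <= p0 <= 1 -> f0 <= f1 -> g0 <= g1 -> h <= j1 - j0 -> 0 <= b ->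
  `|p1 - p0| <= a -> `|f1 - g1| <= d' -> a * d' <= b * h ->
  f0 - p0 * (f0 - g0) + b * j0 <= f1 - p1 * (f1 - g1) + b * j1.
Proof.
move=> /andP[p00 p01] ff gg jh b0 pa hd sm; rewrite -subr_ge0.
have -> : f1 - p1 * (f1 - g1) + b * j1 - (f0 - p0 * (f0 - g0) + b * j0) =
  (1 - p0) * (f1 - f0) + p0 * (g1 - g0) - (p1 - p0) * (f1 - g1) + b * (j1 - j0) by ring.
have t1 : 0 <= (1 - p0) * (f1 - f0) by apply: mulr_ge0; lra.
have t2 : 0 <= p0 * (g1 - g0) by apply: mulr_ge0; lra.
have t3 : (p1 - p0) * (f1 - g1) <= a * d'.
  by apply: le_trans (ler_norm _) _; rewrite normrM; exact: ler_pM.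
have := ler_wpM2l b0 jh; lra.
Qed.

End Arithmetic.

Section Smoothing.
Variables (R : realType) (X : finType) (f : {set X} -> R) (G : {group {perm X}}).
Implicit Types (x y v w : {ffun X -> R}) (h t : R).

Local Notation e := (@basis_vec R X).
Local Notation bar := (symmetrize G).
Local Notation k := (#|X|%:R : R).

(** * Norms and the distance from symmetric points *)

Lemma l1normD x y : l1norm (x + y) <= l1norm x + l1norm y.
Proof.
rewrite /l1norm -big_split /=; apply: ler_sum => i _.
by rewrite ffunE ler_normD.
Qed.

Lemma l1normN x : l1norm (- x) = l1norm x.
Proof. by apply: eq_bigr => i _; rewrite ffunE normrN. Qed.

Lemma l1normZ t x : l1norm (t *: x) = `|t| * l1norm x.
Proof.
rewrite /l1norm mulr_sumr; apply: eq_bigr => i _.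
by rewrite ffunE -normrM.
Qed.

Lemma l1norm_ge0 x : 0 <= l1norm x.
Proof. exact: sumr_ge0. Qed.

Definition dot x y : R := \sum_j x j * y j.

Definition asym x := x - bar x.

Definition asym_sq x : R := dot (asym x) (asym x).

Lemma dotC x y : dot x y = dot y x.
Proof. by apply: eq_bigr => j _; rewrite mulrC. Qed.

Lemma dotDl x y w : dot (x + y) w = dot x w + dot y w.
Proof. by rewrite /dot -big_split; apply: eq_bigr => j _; rewrite ffunE mulrDl. Qed.

Lemma dotZl t x w : dot (t *: x) w = t * dot x w.
Proof.
by rewrite /dot mulr_sumr; apply: eq_bigr => j _; rewrite ffunE mulrA.
Qed.

Lemma dotDr x y w : dot w (x + y) = dot w x + dot w y.
Proof. by rewrite dotC dotDl !(dotC w). Qed.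

Lemma dotZr t x w : dot w (t *: x) = t * dot w x.
Proof. by rewrite dotC dotZl (dotC w). Qed.

Lemma dot_bound x w : (forall j, `|w j| <= 1) -> `|dot x w| <= l1norm x.
Proof.
move=> w1; apply: (le_trans (ler_norm_sum _ _ _)); apply: ler_sum => j _.
by rewrite normrM ler_piMr.
Qed.

(** Cauchy-Schwarz against the constant vector: a product of two absolute values is at most the mean
    of their squares. *)
Lemma l1norm_sq_le x : l1norm x ^+ 2 <= k * dot x x.
Proof.
have -> : k * dot x x = \sum_i \sum_j (x i ^+ 2 + x j ^+ 2) / 2.
  rewrite (eq_bigr (fun i => k * x i ^+ 2 / 2 + dot x x / 2)) => [|i _].
    rewrite big_split /= sumr_const -!mulr_suml -mulr_sumr -(mulr_natl (_ / 2)).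
    by rewrite (_ : \sum_i x i ^+ 2 = dot x x); [field|apply: eq_bigr].
  rewrite -mulr_suml big_split /= sumr_const -(mulr_natl (x i ^+ 2)).
  by rewrite (_ : \sum_i x i ^+ 2 = dot x x); [field|apply: eq_bigr].
rewrite expr2 /l1norm mulr_suml; apply: ler_sum => i _; rewrite mulr_sumr.
apply: ler_sum => j _.
rewrite -(real_normK (num_real (x i))) -(real_normK (num_real (x j))).
rewrite ler_pdivlMr //; have := sqr_ge0 (`|x i| - `|x j|); rewrite !expr2; lra.
Qed.

Lemma asymD x y : asym (x + y) = asym x + asym y.
Proof. by rewrite /asym symmetrizeD opprD addrACA. Qed.

Lemma asymZ t x : asym (t *: x) = t *: asym x.
Proof. by rewrite /asym symmetrizeZ scalerBr. Qed.

Lemma asymE x j : asym x j = x j - bar x j.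
Proof. by rewrite /asym ffunE; congr (_ + _); rewrite ffunE. Qed.

Lemma basis_in_box i : in_box 0 1 (e i).
Proof. by move=> j; rewrite ffunE; case: eqP => _; rewrite ?lexx ?ler01. Qed.

Lemma asym_coord_le1 x j : in_box 0 1 x -> `|asym x j| <= 1.
Proof.
move=> xb; have xb' := @symmetrize_in_box _ _ G _ _ _ xb.
rewrite asymE ler_norml; have := xb j; have := xb' j.
by move=> /andP[? ?] /andP[? ?]; apply/andP; split; lra.
Qed.

Lemma l1norm_asym_le x : in_box 0 1 x -> l1norm (asym x) <= k.
Proof.
move=> xb; have -> : k = \sum_(j : X) 1 :> R by rewrite sumr_const.
by apply: ler_sum => j _; apply: asym_coord_le1.
Qed.

(** Both the basis vector and its symmetrization are nonnegative with coordinate sum 1. *)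
Lemma l1norm_asym_basis i : l1norm (asym (e i)) <= 2.
Proof.
apply: (le_trans (l1normD _ _)); rewrite l1normN.
have s1 : \sum_j e i j = 1.
  rewrite (bigD1 i) //= ffunE eqxx big1 ?addr0 // => j /negbTE ji.
  by rewrite ffunE ji.
have nE x : in_box 0 1 x -> l1norm x = \sum_j x j.
  by move=> xb; apply: eq_bigr => j _; rewrite ger0_norm //; case/andP: (xb j).
rewrite !nE; [|exact/symmetrize_in_box/basis_in_box|exact: basis_in_box].
by rewrite symmetrize_sum s1.
Qed.

Lemma asym_step x h i : asym (x + h *: e i) = asym x + h *: asym (e i).
Proof. by rewrite asymD asymZ. Qed.

Lemma l1norm_asym_step x h i : 0 <= h ->
  l1norm (asym (x + h *: e i)) <= l1norm (asym x) + 2 * h.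
Proof.
move=> h0; rewrite asym_step; apply: (le_trans (l1normD _ _)).
rewrite lerD2l l1normZ ger0_norm // mulrC.
by apply: ler_wpM2r => //; exact: l1norm_asym_basis.
Qed.

Lemma asym_sq_step x h i : 0 <= h ->
  `|asym_sq (x + h *: e i) - asym_sq x| <= 2 * h * l1norm (asym x) + 2 * h ^+ 2.
Proof.
move=> h0; have b1 j : `|asym (e i) j| <= 1 by exact/asym_coord_le1/basis_in_box.
have h1 := dot_bound (asym x) b1.
have h2 := le_trans (dot_bound (asym (e i)) b1) (l1norm_asym_basis i).
have -> : asym_sq (x + h *: e i) - asym_sq x =
    2 * h * dot (asym x) (asym (e i)) + h ^+ 2 * dot (asym (e i)) (asym (e i)).
  rewrite /asym_sq asym_step; move: (asym x) (asym (e i)) => a b.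
  by rewrite !(dotDl, dotDr, dotZl, dotZr) (dotC b a); ring.
apply: (le_trans (ler_normD _ _)); rewrite !normrM (ger0_norm h0) normr_nat.
have A1 := ler_wpM2l (mulr_ge0 h0 h0) h2; have A2 := ler_wpM2l h0 h1.
rewrite expr2; lra.
Qed.

Lemma asym_sq_diff2 x h i j : 0 <= h ->
  `|asym_sq (x + h *: e i + h *: e j) - asym_sq (x + h *: e i)
    - asym_sq (x + h *: e j) + asym_sq x| <= 4 * h ^+ 2.
Proof.
move=> h0; have b1 : forall a, `|asym (e j) a| <= 1.
  by move=> a; exact/asym_coord_le1/basis_in_box.
have h2 := le_trans (dot_bound (asym (e i)) b1) (l1norm_asym_basis i).
have -> : asym_sq (x + h *: e i + h *: e j) - asym_sq (x + h *: e i)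
    - asym_sq (x + h *: e j) + asym_sq x = 2 * h ^+ 2 * dot (asym (e i)) (asym (e j)).
  rewrite /asym_sq !asym_step; move: (asym x) (asym (e i)) (asym (e j)) => a b c.
  by rewrite !(dotDl, dotDr, dotZl, dotZr) (dotC b a) (dotC c a) (dotC c b); ring.
rewrite normrM ger0_norm; last by rewrite mulr_ge0 // sqr_ge0.
have := ler_wpM2l (sqr_ge0 h) h2; lra.
Qed.

(** * Size and increments of the gap between F(x) and F(bar x) *)

Hypotheses (f_ge0 : nonneg_setfun f) (f_submod : submodular f).
Hypothesis f_sym : forall S s, s \in G -> f S = f (s @: S).

Local Notation F := (multilinear f).

Definition gap_fun x := F x - F (bar x).

Lemma box_widen x : in_box 0 1 x -> in_box (-1) 2 x.
Proof. by move=> xb j; have /andP[? ?] := xb j; apply/andP; split; lra. Qed.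

Lemma second_diff_bound : exists2 C : R, 0 <= C &
  forall i j x, in_box (-1) 2 x -> `|multilinear (diff_set j (diff_set i f)) x| <= C.
Proof.
pose c i j := (\sum_S `|diff_set j (diff_set i f) S|) * 2 ^+ #|X| : R.
have c0 i j : 0 <= c i j by rewrite mulr_ge0 ?exprn_ge0 ?sumr_ge0.
exists (\sum_i \sum_j c i j); first by do 2!apply: sumr_ge0 => ? _.
move=> i j x xb; apply: (le_trans (multilinear_bound _ xb)).
rewrite -/(c i j) (bigD1 i) //= (bigD1 j) //= -addrA lerDl addr_ge0 //.
  by apply: sumr_ge0.
by do 2!apply: sumr_ge0 => ? _.
Qed.

Variable C : R.
Hypothesis C_ge0 : 0 <= C.
Hypothesis C_bound : forall i j x, in_box (-1) 2 x ->
  `|multilinear (diff_set j (diff_set i f)) x| <= C.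

Lemma gap_fun_bound x : in_box (-1) 2 x -> `|gap_fun x| <= C * l1norm (asym x) ^+ 2.
Proof. exact: multilinear_symmetrize. Qed.

(** Since x + h e_i and bar x + h e_i have the same symmetrization, the increment is [h] times the
    change of a partial derivative between bar x and x, plus the gap at bar x + h e_i. The latter is
    quadratic, the 4 being the square of the bound in [l1norm_asym_basis]. *)
Lemma gap_fun_step x h i : 0 <= h <= 1 -> in_box 0 1 x -> in_box 0 1 (x + h *: e i) ->
  `|gap_fun (x + h *: e i) - gap_fun x| <= C * (h * l1norm (asym x) + 4 * h ^+ 2).
Proof.
move=> /andP[h0 h1] xb yb; have pb := @symmetrize_in_box _ _ G _ _ _ xb.
have qb : in_box (-1) 2 (bar x + h *: e i).
  move=> j; rewrite add_stepE; have /andP[p1 p2] := pb j.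
  by case: eqP => _; rewrite ?mulr0 ?mulr1; apply/andP; split; lra.
have -> : gap_fun (x + h *: e i) - gap_fun x =
    h * (multilinear (diff_set i f) x - multilinear (diff_set i f) (bar x)) +
    gap_fun (bar x + h *: e i).
  rewrite /gap_fun !multilinear_step !symmetrizeD symmetrizeK; ring.
apply: (le_trans (ler_normD _ _)); rewrite [leRHS]mulrDr; apply: lerD.
  rewrite normrM ger0_norm // mulrCA; apply: ler_wpM2l => //.
  apply: (multilinear_lipschitz _ (box_widen pb) (box_widen xb)) => j z zb.
  exact: C_bound.
apply: (le_trans (gap_fun_bound qb)); apply: ler_wpM2l => //.
have -> : asym (bar x + h *: e i) = h *: asym (e i).
  by rewrite asym_step /asym symmetrizeK subrr add0r.
rewrite l1normZ (ger0_norm h0) exprMn mulrC; apply: ler_wpM2r; first exact: sqr_ge0.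
have -> : 4 = 2 ^+ 2 :> R by rewrite expr2; ring.
by rewrite ler_pXn2r ?nnegrE ?l1norm_ge0 // l1norm_asym_basis.
Qed.

Lemma box_sum x : in_box 0 1 x -> 0 <= \sum_j x j <= k.
Proof.
move=> xb; apply/andP; split; first by apply: sumr_ge0 => j _; case/andP: (xb j).
have -> : k = \sum_(j : X) 1 :> R by rewrite sumr_const.
by apply: ler_sum => j _; case/andP: (xb j).
Qed.

Lemma sum_step x h i : \sum_j (x + h *: e i) j = \sum_j x j + h.
Proof.
rewrite (bigD1 i) //= [in RHS](bigD1 i) //= add_stepE eqxx mulr1 addrAC.
by congr (_ + _ + _); apply: eq_bigr => j /negbTE ji; rewrite add_stepE ji mulr0 addr0.
Qed.

(* A symmetric function, increasing on the cube, all of whose second partial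
   derivatives are -2: a small multiple absorbs the errors due to the cutoff. *)
Definition damping x : R := let s := \sum_j x j in s * (3 * k - s).

Lemma damping_range x : in_box 0 1 x -> 0 <= damping x <= 3 * k ^+ 2.
Proof. by move=> /box_sum/andP[s0 sk]; rewrite /damping; apply/andP; split; nra. Qed.

Lemma damping_diff2 x h i j :
  damping (x + h *: e i + h *: e j) - damping (x + h *: e i) - damping (x + h *: e j)
  + damping x = - 2 * h ^+ 2.
Proof. by rewrite /damping !sum_step; ring. Qed.

Lemma damping_step x h i : 0 <= h -> in_box 0 1 x -> in_box 0 1 (x + h *: e i) ->
  h <= damping (x + h *: e i) - damping x.
Proof.
move=> h0 /box_sum/andP[s0 sk] /box_sum; rewrite sum_step => /andP[s0' sk'].
rewrite /damping sum_step.
have k1 : 1 <= k by rewrite ler1n; apply/card_gt0P; exists i.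
set s := \sum_j x j in s0 sk s0' sk' *.
have -> : (s + h) * (3 * k - (s + h)) - s * (3 * k - s) = h * (3 * k - 2 * s - h) by ring.
by rewrite ler_peMr //; lra.
Qed.

(** The case [i = j] is included, because under the hidden permutations two elements of the ground
    set can count for the same coordinate. *)
Definition locally_submodular (u : {ffun X -> R} -> R) h :=
  forall x i j, in_box 0 1 x -> in_box 0 1 (x + h *: e i + h *: e j) ->
  u (x + h *: e i + h *: e j) - u (x + h *: e i) - u (x + h *: e j) + u x <= 0.

Definition locally_monotone (u : {ffun X -> R} -> R) h :=
  forall x i, in_box 0 1 x -> in_box 0 1 (x + h *: e i) -> u x <= u (x + h *: e i).

Lemma basis_scale_ge0 h i j : 0 <= h -> 0 <= (h *: e i) j.
Proof. by move=> h0; rewrite !ffunE; apply: mulr_ge0 => //; rewrite ler0n. Qed.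

Lemma bar_basis_scale_ge0 h i j : 0 <= h -> 0 <= bar (h *: e i) j.
Proof.
move=> h0; rewrite symmetrizeE mulr_ge0 ?invr_ge0 ?ler0n // sumr_ge0 // => s _.
exact: basis_scale_ge0.
Qed.

Lemma multilinear_locally_submodular h : 0 <= h -> locally_submodular F h.
Proof.
by move=> h0 x i j xb yb; apply: multilinear_dr => // a; apply: basis_scale_ge0.
Qed.

Lemma multilinear_bar_locally_submodular h : 0 <= h ->
  locally_submodular (fun x => F (bar x)) h.
Proof.
move=> h0 x i j xb yb; rewrite !symmetrizeD.
apply: multilinear_dr => //; try by move=> a; apply: bar_basis_scale_ge0.
  exact: symmetrize_in_box.
by rewrite -!symmetrizeD; exact: symmetrize_in_box.
Qed.

Lemma multilinear_locally_monotone h : monotone_setfun f -> 0 <= h ->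
  locally_monotone F h.
Proof.
by move=> fm h0 x i xb yb; apply: multilinear_homo => // a; apply: basis_scale_ge0.
Qed.

Lemma multilinear_bar_locally_monotone h : monotone_setfun f -> 0 <= h ->
  locally_monotone (fun x => F (bar x)) h.
Proof.
move=> fm h0 x i xb yb; rewrite symmetrizeD.
apply: multilinear_homo => //; first by move=> a; apply: bar_basis_scale_ge0.
  exact: symmetrize_in_box.
by rewrite -symmetrizeD; exact: symmetrize_in_box.
Qed.

(** * The smoothed function and its symmetric counterpart *)

Variables (delta : R) (K : nat).
Hypotheses (delta_gt0 : 0 < delta) (K_gt0 : (0 < K)%N).

Local Notation phi := (cutoff delta K).
Local Notation m := (2 * k + 2).
(** The factor 1/K comes from the differences of the cutoff; a large [K] makes the damping as small
    as desired. *)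
Definition damping_coef : R := (K%:R)^-1 * (128 * 128 * C * m ^+ 2).
Local Notation beta := damping_coef.

Definition symmetric_part x := F (bar x) + beta * damping x.

Definition smoothing x := F x - phi (asym_sq x) * gap_fun x + beta * damping x.

Lemma smoothing_eq x : phi (asym_sq x) = 1 -> smoothing x = symmetric_part x.
Proof. by move=> p1; rewrite /smoothing p1 /symmetric_part /gap_fun; ring. Qed.

Lemma beta_ge0 : 0 <= beta.
Proof. rewrite /damping_coef; apply: mulr_ge0; first by rewrite invr_ge0.
by apply: mulr_ge0; [apply: mulr_ge0 => //; exact: mulr_ge0|exact: sqr_ge0]. Qed.

Lemma in_box_step_l x h i j : 0 <= h -> in_box 0 1 x ->
  in_box 0 1 (x + h *: e i + h *: e j) -> in_box 0 1 (x + h *: e i).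
Proof.
move=> h0 xb yb a; have := xb a; have := yb a.
rewrite !add_stepE; move=> /andP[? ?] /andP[? ?].
have := mulr_ge0 h0 (ler0n R (a == i)); have := mulr_ge0 h0 (ler0n R (a == j)).
by move=> ? ?; apply/andP; split; lra.
Qed.

Section Step.
Variables (h : R) (x : {ffun X -> R}).
Hypotheses (h_gt0 : 0 < h) (h_le1 : h <= 1) (h_small : h * (4 * k + 8) <= delta / 4).
Hypothesis x_box : in_box 0 1 x.

Local Notation l := (l1norm (asym x)).
Local Notation D := (asym_sq x).
Local Notation L := (l + h).

Let h_ge0 : 0 <= h. Proof. exact: ltW. Qed.
Let h_range : 0 <= h <= 1. Proof. by rewrite h_ge0. Qed.
Let l_le : l <= k. Proof. exact: l1norm_asym_le. Qed.

Lemma asym_sq_near i :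
  `|asym_sq (x + h *: e i) - D| <= 2 * h * L /\ 2 * h * L <= delta / 4.
Proof.
split; last by apply: (step_small h_range _ l_le h_small); rewrite ler0n.
apply: (le_trans (asym_sq_step x i h_ge0)).
by rewrite mulrDr expr2 mulrA.
Qed.

Lemma asym_sq_near2 i j : `|asym_sq (x + h *: e i + h *: e j) - D| <= delta / 4.
Proof.
have h1 := asym_sq_step x i h_ge0.
have h2 := asym_sq_step (x + h *: e i) j h_ge0.
have h3 := l1norm_asym_step x i h_ge0.
apply: (le_trans (ler_distD (asym_sq (x + h *: e i)) _ _)).
exact: le_trans (lerD h2 h1) (step2_small h_range l_le h3 h_small).
Qed.

Lemma smoothing_near : D < delta / 2 ->
  [/\ phi D = 1, forall i, phi (asym_sq (x + h *: e i)) = 1 &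
     forall i j, phi (asym_sq (x + h *: e i + h *: e j)) = 1].
Proof.
move=> Dd; split=> [|i|i j]; apply: cutoff_le => //; apply: near_small Dd => //.
- by rewrite subrr normr0; apply: divr_ge0 => //; exact: ltW.
- by have [n1 n2] := asym_sq_near i; exact: le_trans n1 n2.
- exact: asym_sq_near2.
Qed.

Hypothesis D_large : delta / 2 <= D.

Let D_gt0 : 0 < D.
Proof. by apply: lt_le_trans D_large; rewrite divr_gt0. Qed.

Let mid0 : D / 2 <= D <= 2 * D.
Proof. by apply: (near_large delta_gt0) D_large; rewrite subrr normr0 divr_ge0 // ltW. Qed.

Let mid1 i : D / 2 <= asym_sq (x + h *: e i) <= 2 * D.
Proof.
have [n1 n2] := asym_sq_near i.
exact: near_large delta_gt0 (le_trans n1 n2) D_large.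
Qed.

Lemma l1norm_step_sq_le : L ^+ 2 <= m * D.
Proof.
by apply: (sum_sq_small h_range _ h_small delta_gt0 D_large) => //; exact: l1norm_sq_le.
Qed.

Lemma cutoff_step i : `|phi (asym_sq (x + h *: e i)) - phi D| <=
  (K%:R)^-1 * (64 * (h * L / D)).
Proof.
have [n1 _] := asym_sq_near i.
apply: (le_trans (cutoff_lip delta_gt0 K_gt0 D_gt0 mid0 (mid1 i))).
apply: ler_wpM2l; first by rewrite invr_ge0.
by apply/first_order_rescale/ler_wpM2r => //; rewrite invr_ge0 ltW.
Qed.

Lemma cutoff_step2 i j :
  `|phi (asym_sq (x + h *: e i + h *: e j)) - phi (asym_sq (x + h *: e i))
    - phi (asym_sq (x + h *: e j)) + phi D| <=
  (K%:R)^-1 * (128 * (h ^+ 2 / D) + 512 * (h ^+ 2 * L ^+ 2 / D ^+ 2)).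
Proof.
have [n1 _] := asym_sq_near i; have [n3 _] := asym_sq_near j.
have n6 := asym_sq_diff2 x i j h_ge0.
have mid2 := near_large delta_gt0 (asym_sq_near2 i j) D_large.
apply: (le_trans (cutoff_diff2 delta_gt0 K_gt0 D_gt0 mid0 (mid1 i) (mid1 j) mid2)).
apply: ler_wpM2l; first by rewrite invr_ge0.
have Di : 0 <= D^-1 by rewrite invr_ge0 ltW.
have Di2 : 0 <= (D ^+ 2)^-1 by rewrite invr_ge0 sqr_ge0.
have t1 := ler_wpM2r Di n6.
have t2 := ler_wpM2r Di2 (ler_pM (normr_ge0 _) (normr_ge0 _) n1 n3).
exact: second_order_rescale.
Qed.

Let L_ge0 : 0 <= L.
Proof. by rewrite addr_ge0 ?l1norm_ge0. Qed.

Lemma gap_fun_mixed_step i j :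
  in_box 0 1 (x + h *: e i) -> in_box 0 1 (x + h *: e i + h *: e j) ->
  `|gap_fun (x + h *: e i + h *: e j) - gap_fun (x + h *: e i)| <= C * (6 * (h * L)).
Proof.
move=> xib yb; apply: (le_trans (gap_fun_step h_range xib yb)).
apply: ler_wpM2l => //; apply: mixed_step_small => //.
  exact: l1norm_ge0.
exact: l1norm_asym_step.
Qed.

Lemma gap_fun_near i : in_box 0 1 (x + h *: e i) ->
  `|gap_fun (x + h *: e i)| <= C * (4 * L ^+ 2).
Proof.
move=> yb; apply: (le_trans (gap_fun_bound (box_widen yb))); apply: ler_wpM2l => //.
have -> : 4 * L ^+ 2 = (2 * L) ^+ 2 :> R by rewrite !expr2; ring.
rewrite ler_pXn2r ?nnegrE ?l1norm_ge0 ?mulr_ge0 //.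
apply: (le_trans (l1norm_asym_step x i h_ge0)); rewrite mulrDr lerD2r.
by rewrite mulr_natl mulr2n lerDl l1norm_ge0.
Qed.

Lemma gap_fun_near2 i j : in_box 0 1 (x + h *: e i + h *: e j) ->
  `|gap_fun (x + h *: e i + h *: e j)| <= C * (16 * L ^+ 2).
Proof.
move=> yb; apply: (le_trans (gap_fun_bound (box_widen yb))); apply: ler_wpM2l => //.
have -> : 16 * L ^+ 2 = (4 * L) ^+ 2 :> R by rewrite !expr2; ring.
rewrite ler_pXn2r ?nnegrE ?l1norm_ge0 ?mulr_ge0 //.
apply: (le_trans (l1norm_asym_step _ j h_ge0)).
apply: (le_trans (lerD (l1norm_asym_step x i h_ge0) (lexx _))).
by apply: two_steps_small => //; exact: l1norm_ge0.
Qed.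

End Step.

Let Kinv_ge0 : 0 <= (K%:R)^-1 :> R.
Proof. by rewrite invr_ge0. Qed.

Let m_ge2 : 2 <= m.
Proof. by rewrite lerDr mulr_ge0. Qed.

Lemma smoothing_locally_submodular h : 0 < h -> h <= 1 ->
  h * (4 * k + 8) <= delta / 4 -> locally_submodular smoothing h.
Proof.
move=> h0 h1 hs x i j xb yb; have h0' := ltW h0.
have xib := in_box_step_l h0' xb yb.
have yb' : in_box 0 1 (x + h *: e j + h *: e i) by rewrite addrAC.
have xjb := in_box_step_l h0' xb yb'.
have dF := multilinear_locally_submodular h0' xb yb.
have dG := multilinear_bar_locally_submodular h0' xb yb.
have dJ := damping_diff2 x h i j.
have pr := cutoff_range delta K_gt0 (asym_sq x).
have [Dl|Ds] := leP (delta / 2) (asym_sq x); last first.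
  have [p0 p1 p2] := smoothing_near h0 h1 hs xb Ds.
  rewrite (smoothing_eq p0) (smoothing_eq (p1 i)) (smoothing_eq (p1 j)) (smoothing_eq (p2 i j)).
  exact: add_damping_diff2 dG dJ beta_ge0.
(* Away from symmetry each factor is bounded separately; the powers of l + h and of [asym_sq x]
   cancel by [l1norm_step_sq_le], leaving an error of order h^2 / K. *)
apply: (leibniz_diff2 pr dF dG dJ (cutoff_step h0 h1 hs xb Dl i)
  (cutoff_step h0 h1 hs xb Dl j) (gap_fun_mixed_step h0 h1 xib yb) _
  (cutoff_step2 h0 h1 hs xb Dl i j) (gap_fun_near2 h0 yb)).
  have := gap_fun_mixed_step h0 h1 xjb yb'.
  by rewrite [x + h *: e j + _]addrAC.
have D0 : 0 < asym_sq x by apply: lt_le_trans Dl; rewrite divr_gt0.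
have LD := l1norm_step_sq_le h0 h1 hs Dl.
have t1 := cross_term_bound h Kinv_ge0 C_ge0 D0 LD.
have t2 := main_term_bound h Kinv_ge0 C_ge0 D0 LD.
apply: le_trans (error_terms_bound h Kinv_ge0 C_ge0 m_ge2).
by apply: lerD t2; apply: lerD.
Qed.

Lemma smoothing_locally_monotone h : monotone_setfun f -> 0 < h -> h <= 1 ->
  h * (4 * k + 8) <= delta / 4 -> locally_monotone smoothing h.
Proof.
move=> fm h0 h1 hs x i xb yb; have h0' := ltW h0.
have dF := multilinear_locally_monotone fm h0' xb yb.
have dG := multilinear_bar_locally_monotone fm h0' xb yb.
have dJ := damping_step h0' xb yb.
have pr := cutoff_range delta K_gt0 (asym_sq x).
have [Dl|Ds] := leP (delta / 2) (asym_sq x); last first.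
  have [p0 p1 _] := smoothing_near h0 h1 hs xb Ds.
  (* The cutoff is 1 at both ends, so the product rule has no error term. *)
  apply: (leibniz_diff1 (a := 0) pr dF dG dJ beta_ge0 _ (lexx _)).
    by rewrite p0 p1 subrr normr0.
  by rewrite mul0r mulr_ge0 // beta_ge0.
apply: (leibniz_diff1 pr dF dG dJ beta_ge0 (cutoff_step h0 h1 hs xb Dl i)
  (gap_fun_near h0 yb)).
have D0 : 0 < asym_sq x by apply: lt_le_trans Dl; rewrite divr_gt0.
apply: monotone_term_bound => //; last exact: (l1norm_step_sq_le h0 h1 hs Dl).
have k0 : 0 <= k by [].
have := l1norm_asym_le xb; have := l1norm_ge0 (asym x).
by move=> ? ?; apply/andP; split; lra.
Qed.

Lemma symmetric_part_locally_submodular h : 0 < h -> locally_submodular symmetric_part h.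
Proof.
move=> h0 x i j xb yb; have dG := multilinear_bar_locally_submodular (ltW h0) xb yb.
have dJ := damping_diff2 x h i j; have b0 := beta_ge0.
exact: (add_damping_diff2 dG dJ beta_ge0).
Qed.

Lemma symmetric_part_locally_monotone h : monotone_setfun f -> 0 < h ->
  locally_monotone symmetric_part h.
Proof.
move=> fm h0 x i xb yb.
have dG := multilinear_bar_locally_monotone fm (ltW h0) xb yb.
have dJ := damping_step (ltW h0) xb yb.
apply: lerD => //; apply: ler_wpM2l; first exact: beta_ge0.
by rewrite -subr_ge0 (le_trans (ltW h0)).
Qed.

Lemma smoothing_ge0 x : in_box 0 1 x -> 0 <= smoothing x.
Proof.
move=> xb; have /andP[p0 p1] := cutoff_range delta K_gt0 (asym_sq x).
have -> : smoothing x = (1 - phi (asym_sq x)) * F x + phi (asym_sq x) * F (bar x)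
    + beta * damping x by rewrite /smoothing /gap_fun; ring.
have /andP[d0 _] := damping_range xb.
apply: addr_ge0; last by apply: mulr_ge0 => //; exact: beta_ge0.
apply: addr_ge0; apply: mulr_ge0 => //; try by rewrite subr_ge0.
  exact: multilinear_ge0.
exact/multilinear_ge0/symmetrize_in_box.
Qed.

Lemma symmetric_part_ge0 x : in_box 0 1 x -> 0 <= symmetric_part x.
Proof.
move=> xb; have /andP[d0 _] := damping_range xb.
apply: addr_ge0; first exact/multilinear_ge0/symmetrize_in_box.
by apply: mulr_ge0 => //; exact: beta_ge0.
Qed.

(** The damping depends only on the sum of the coordinates, which symmetrization preserves. *)
Lemma symmetric_part_bar x y : bar x = bar y -> symmetric_part x = symmetric_part y.
Proof.
move=> xy; rewrite /symmetric_part xy /damping -(symmetrize_sum G x) xy.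
by rewrite symmetrize_sum.
Qed.

Lemma smoothing_symmetric_part x : asym_sq x <= delta -> smoothing x = symmetric_part x.
Proof. by move=> xd; apply/smoothing_eq/cutoff_le. Qed.

(** * Closeness to the multilinear extension *)

Variable eps : R.
Hypothesis damping_small : beta * (3 * k ^+ 2) <= eps / 2.
Hypothesis scale_small : C * k * (2 * (delta * 16 ^+ K.-1)) <= eps / 2.

Let damping_le x : in_box 0 1 x -> 0 <= beta * damping x <= eps / 2.
Proof.
move=> /damping_range/andP[d0 d1]; rewrite mulr_ge0 ?beta_ge0 //=.
by apply: le_trans damping_small; apply: ler_wpM2l => //; exact: beta_ge0.
Qed.

Lemma symmetric_part_approx x : in_box 0 1 x -> `|symmetric_part x - F (bar x)| <= eps / 2.
Proof.
by move=> /damping_le/andP[d0 d1]; rewrite /symmetric_part addrAC subrr add0r ger0_norm.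
Qed.

(** Half of [eps] pays for the damping. Beyond twice the largest scale the cutoff is 0; below, the
    gap is at most [C * k] times [asym_sq x], small by [scale_small]. *)
Lemma smoothing_approx x : in_box 0 1 x -> `|smoothing x - F x| <= eps.
Proof.
move=> xb; have /andP[d0 d1] := damping_le xb.
have -> : smoothing x - F x = beta * damping x - phi (asym_sq x) * gap_fun x.
  by rewrite /smoothing; ring.
rewrite (splitr eps); apply: (le_trans (ler_normB _ _)); apply: lerD.
  by rewrite ger0_norm.
have [big|small] := leP (2 * (delta * 16 ^+ K.-1)) (asym_sq x).
  by rewrite cutoff_ge // mul0r normr0 (le_trans d0).
have /andP[p0 p1] := cutoff_range delta K_gt0 (asym_sq x).
rewrite normrM ger0_norm //.
have gb := gap_fun_bound (box_widen xb).
have lb := ler_wpM2l C_ge0 (l1norm_sq_le (asym x)).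
have kb := ler_wpM2l (mulr_ge0 C_ge0 (ler0n R #|X|)) (ltW small).
apply: le_trans scale_small; apply: le_trans kb; rewrite -mulrA; apply: le_trans lb.
apply: le_trans gb; rewrite -[leRHS]mul1r.
exact: ler_wpM2r.
Qed.

End Smoothing.

Lemma archimedean_div (R : realType) (a b : R) : 0 <= a -> 0 < b ->
  exists2 K : nat, (0 < K)%N & (K%:R)^-1 * a <= b.
Proof.
move=> a0 b0; have ab : 0 <= a / b by rewrite divr_ge0 // ltW.
have := archi_boundP ab; set K := Num.bound _ => abK.
have K0 : 0 < K%:R :> R by apply: le_lt_trans abK.
exists K; first by rewrite ltr0n in K0.
by rewrite mulrC ler_pdivrMr // mulrC -ler_pdivrMr // ltW.
Qed.

(** Order of choice: [K] so large that the damping is at most [eps / 2], then [delta] so small that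
    even the largest scale is negligible, then the bound on the step in terms of [delta]. *)
Lemma smoothing_exists (R : realType) (X : finType) (f : {set X} -> R)
    (G : {group {perm X}}) (eps : R) :
  nonneg_setfun f -> submodular f -> (forall S s, s \in G -> f S = f (s @: S)) ->
  0 < eps ->
  exists (Phi Gam : {ffun X -> R} -> R) (delta h0 : R),
  [/\ 0 < delta, 0 < h0,
    forall x, in_box 0 1 x -> [/\ 0 <= Phi x, 0 <= Gam x,
      `|Phi x - multilinear f x| <= eps &
      `|Gam x - multilinear f (symmetrize G x)| <= eps],
    forall x y, symmetrize G x = symmetrize G y -> Gam x = Gam y &
    forall x, asym_sq G x <= delta -> Phi x = Gam x] /\
  forall h, 0 < h <= h0 -> [/\ locally_submodular Phi h, locally_submodular Gam h &
    monotone_setfun f -> locally_monotone Phi h /\ locally_monotone Gam h].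
Proof.
move=> f0 fs fG e0; have [C C0 Cb] := second_diff_bound f.
pose k : R := #|X|%:R; have k0 : 0 <= k by exact: ler0n.
pose A := 128 * 128 * C * (2 * k + 2) ^+ 2 * (3 * k ^+ 2).
have A0 : 0 <= A.
  apply: mulr_ge0; last by apply: mulr_ge0 => //; exact: sqr_ge0.
  by apply: mulr_ge0; [apply: mulr_ge0 => //; exact: mulr_ge0|exact: sqr_ge0].
have e20 : 0 < eps / 2 by rewrite divr_gt0.
have [K K0 KA] := archimedean_div A0 e20.
have Ck : 0 < C * k + 1 by rewrite ltr_wpDl // mulr_ge0.
pose delta := eps / 4 / (C * k + 1) / 16 ^+ K.-1.
have p16 : 0 < 16 ^+ K.-1 :> R by rewrite exprn_gt0.
have d0 : 0 < delta by rewrite /delta !divr_gt0.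
have k48 : 0 < 4 * k + 8 by rewrite ltr_wpDl // mulr_ge0.
exists (smoothing f G C delta K), (symmetric_part f G C K), delta,
  (Num.min 1 (delta / 4 / (4 * k + 8))).
have ds : damping_coef X C K * (3 * #|X|%:R ^+ 2) <= eps / 2.
  by apply: le_trans KA; rewrite /damping_coef /A !mulrA.
have ss : C * #|X|%:R * (2 * (delta * 16 ^+ K.-1)) <= eps / 2.
  rewrite /delta divfK ?gt_eqF // -/k.
  have -> : C * k * (2 * (eps / 4 / (C * k + 1))) = eps / 2 * (C * k / (C * k + 1)).
    by field; rewrite gt_eqF.
  rewrite -[leRHS]mulr1; apply: ler_wpM2l; first exact: ltW.
  by rewrite ler_pdivrMr // mul1r lerDl.
split; first split => //.
- by rewrite lt_min ltr01 !divr_gt0.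
- move=> x xb; split.
  + exact: smoothing_ge0.
  + exact: symmetric_part_ge0.
  + exact: smoothing_approx.
  + apply: (@le_trans _ _ (eps / 2)); first exact: symmetric_part_approx.
    by rewrite ler_pdivrMr // mulr_natr mulr2n lerDl ltW.
- by move=> x y xy; apply: symmetric_part_bar.
- by move=> x xd; apply: smoothing_symmetric_part.
move=> h /andP[h0]; rewrite le_min => /andP[h1 h2].
have hs : h * (4 * k + 8) <= delta / 4 by rewrite -ler_pdivlMr.
split.
- exact: smoothing_locally_submodular.
- exact: symmetric_part_locally_submodular.
move=> fm; split.
- exact: smoothing_locally_monotone.
- exact: symmetric_part_locally_monotone.
Qed.

(** * Hidden instances *)

Section LocalToGlobal.
Variables (R : realType) (T : finType) (g : {set T} -> R).
Implicit Types (S U : {set T}) (a b : T).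

(** First [marg] compares marginals over nested sets, adding the elements of [U :\: S] to [S] one by
    one; then [main] removes the elements of [S :\: U] from [S], each by one use of [marg]. *)
Lemma submodular_local :
  (forall S a b, a \notin S -> b \notin S -> a != b ->
     g (b |: (a |: S)) - g (a |: S) - g (b |: S) + g S <= 0) ->
  submodular g.
Proof.
move=> loc.
have marg m S U b : #|U :\: S| = m -> S \subset U -> b \notin U ->
    g (b |: U) - g U <= g (b |: S) - g S.
  elim: m S => [|m IH] S.
    move=> /eqP; rewrite cards_eq0 finset.setD_eq0 => US SU bU.
    by have -> : U = S by apply/eqP; rewrite finset.eqEsubset US.
  move=> cU SU bU.
  have /card_gt0P[a] : (0 < #|U :\: S|)%N by rewrite cU.
  rewrite finset.in_setD => /andP[aS aU].
  have ab : a != b by apply: contraNneq bU => <-.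
  have bS : b \notin S by apply: contra bU; apply: (fintype.subsetP SU).
  have SU' : a |: S \subset U by rewrite finset.subUset finset.sub1set aU.
  have cU' : #|U :\: (a |: S)| = m.
    have -> : U :\: (a |: S) = (U :\: S) :\ a.
      by apply/setP => x; rewrite !inE; case: (x == a); case: (x \in S).
    by move: cU; rewrite (cardsD1 a) !inE aS aU /= add1n => -[].
  have h1 := IH _ cU' SU' bU; have h2 := loc S a b aS bS ab.
  lra.
suff main m S U : #|S :\: U| = m -> g (S :|: U) + g (S :&: U) <= g S + g U.
  by move=> S U; exact: (main _ _ _ (erefl _)).
elim: m S => [|m IH] S.
  move=> /eqP; rewrite cards_eq0 finset.setD_eq0 => SU.
  by rewrite (finset.setUidPr SU) (finset.setIidPl SU) addrC.
move=> cS; have /card_gt0P[b] : (0 < #|S :\: U|)%N by rewrite cS.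
rewrite finset.in_setD => /andP[bU bS].
have cS' : #|(S :\ b) :\: U| = m.
  have -> : (S :\ b) :\: U = (S :\: U) :\ b.
    by apply/setP => x; rewrite !inE; case: (x == b); case: (x \in U).
  by move: cS; rewrite (cardsD1 b) !inE bU bS /= add1n => -[].
have := IH _ cS'.
have -> : (S :\ b) :&: U = S :&: U.
  by apply/setP => x; rewrite !inE; case: eqP => //= ->; rewrite (negbTE bU) !andbF.
have bSU : b \notin (S :\ b) :|: U by rewrite !inE eqxx (negbTE bU).
have := marg _ _ _ b (erefl _) (finset.subsetUl (S :\ b) U) bSU.
rewrite finset.setUA !finset.setD1K //; lra.
Qed.

Lemma monotone_local : (forall S a, a \notin S -> g S <= g (a |: S)) -> monotone_setfun g.
Proof.
move=> loc S U; have [m] := ubnP #|U :\: S|; elim: m S => // m IH S.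
have [/eqP|/set0Pn[a]] := eqVneq (U :\: S) finset.set0.
  rewrite finset.setD_eq0 => US _ SU.
  by have -> : U = S by apply/eqP; rewrite finset.eqEsubset US.
rewrite finset.in_setD => /andP[aS aU] cU SU; apply: (le_trans (loc _ _ aS)).
apply: IH; last by rewrite finset.subUset finset.sub1set aU.
move: cU; have -> : U :\: (a |: S) = (U :\: S) :\ a.
  by apply/setP => x; rewrite !inE; case: (x == a); case: (x \in S).
by rewrite (cardsD1 a (U :\: S)) !inE aS aU.
Qed.

End LocalToGlobal.

(** * Densities seen through hidden permutations *)

Section HiddenInstance.
Variables (R : realType) (X : finType) (G : {group {perm X}}) (n : nat).
Implicit Types (S : {set 'I_n * X}) (sg : {ffun 'I_n -> {perm X}}).
Hypothesis n_gt0 : (0 < n)%N.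

Local Notation h := ((n%:R)^-1 : R).

Definition hidden_density sg S : {ffun X -> R} :=
  [ffun j => h * \sum_i ((i, sg i j) \in S)%:R].

Lemma hidden_density_in_box sg S : in_box 0 1 (hidden_density sg S).
Proof.
move=> j; rewrite ffunE; apply/andP; split.
  by rewrite mulr_ge0 ?invr_ge0 // sumr_ge0.
rewrite mulrC ler_pdivrMr ?ltr0n // mul1r.
have -> : n%:R = \sum_(i < n) 1 :> R by rewrite sumr_const card_ord.
by apply: ler_sum => i _; rewrite lern1 leq_b1.
Qed.

Lemma hidden_density_add sg S (i : 'I_n) (j : X) : (i, j) \notin S ->
  hidden_density sg ((i, j) |: S) = hidden_density sg S + h *: basis_vec R ((sg i)^-1%g j).
Proof.
move=> ijS; apply/ffunP => a; rewrite add_stepE !ffunE -mulrDr; congr (_ * _).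
rewrite (bigD1 i) //= [in RHS](bigD1 i) //= !inE xpair_eqE eqxx /=.
rewrite [in RHS]addrAC; congr (_ + _); last first.
  by apply: eq_bigr => b /negbTE bi; rewrite !inE xpair_eqE bi.
have -> : (sg i a == j) = (a == (sg i)^-1%g j).
  by rewrite -(inj_eq (@perm_inj _ (sg i)) a) permKV.
case: eqVneq => [->|_] /=; last by rewrite addr0.
by rewrite permKV (negbTE ijS) add0r.
Qed.

Lemma densityE S j : density R S j = h * \sum_i ((i, j) \in S)%:R.
Proof.
rewrite ffunE; congr (_ * _); rewrite -sum1dep_card big_mkcond /= natr_sum.
rewrite (eq_bigr (fun u : 'I_n * X =>
  (if ((u.1, u.2) \in S) && (u.2 == j) then 1 else 0)%N%:R)) => [|[]//].
rewrite -(pair_bigA _ (fun i a => (if ((i, a) \in S) && (a == j) then 1 else 0)%N%:R)) /=.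
apply: eq_bigr => i _; rewrite (bigD1 j) //= eqxx andbT big1 ?addr0 => [|a /negbTE ->].
  by case: ifP.
by rewrite andbF.
Qed.

(** In each row [i], the permutation [sg i] is absorbed by reindexing the average over [G]. *)
Lemma symmetrize_hidden_density sg S : sg \in ffun_on G ->
  symmetrize G (hidden_density sg S) = symmetrize G (density R S).
Proof.
move=> /ffun_onP sgG; apply/ffunP => j; rewrite !symmetrizeE; congr (_ * _).
under eq_bigr do rewrite ffunE.
under [RHS]eq_bigr do rewrite densityE.
rewrite -!mulr_sumr; congr (_ * _).
rewrite exchange_big [RHS]exchange_big /=; apply: eq_bigr => i _.
rewrite [RHS](reindex_inj (mulIg (sg i))) /=; apply: eq_big => s.
  by rewrite groupMr.
by rewrite permM.
Qed.

Lemma hidden_submodular (u : {ffun X -> R} -> R) sg :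
  locally_submodular u h -> submodular (fun S => u (hidden_density sg S)).
Proof.
move=> us; apply: submodular_local => S [i a] [j b] aS bS ab.
have baS : (j, b) \notin (i, a) |: S by rewrite !inE negb_or bS eq_sym ab.
have E := hidden_density_add sg baS.
rewrite E (hidden_density_add sg aS) (hidden_density_add sg bS).
apply: us; first exact: hidden_density_in_box.
by rewrite -(hidden_density_add sg aS) -E; exact: hidden_density_in_box.
Qed.

Lemma hidden_monotone (u : {ffun X -> R} -> R) sg :
  locally_monotone u h -> monotone_setfun (fun S => u (hidden_density sg S)).
Proof.
move=> um; apply: monotone_local => S [i a] aS; rewrite (hidden_density_add sg aS).
apply: um; first exact: hidden_density_in_box.
by rewrite -(hidden_density_add sg aS); exact: hidden_density_in_box.
Qed.

Definition refinement_family (F : {set {set X}}) : {set {set 'I_n * X}} :=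
  [set S | `[< polytope F (density R S) >]].

Lemma refinement_familyP F : is_refinement R F (refinement_family F).
Proof. by move=> S; rewrite inE; split=> /asboolP. Qed.

Definition average_ind (c : 'I_n -> {set X}) : {ffun X -> R} :=
  [ffun j => h * \sum_i (j \in c i)%:R].

Lemma average_ind_polytope (F : {set {set X}}) c : (forall i, c i \in F) ->
  polytope F (average_ind c).
Proof.
move=> cF; exists (fun S : {set X} => h * \sum_i (c i == S)%:R); split.
- by move=> S _; rewrite mulr_ge0 ?invr_ge0 // sumr_ge0.
- rewrite -mulr_sumr exchange_big /= (eq_bigr (fun=> 1)) => [|i _].
    by rewrite sumr_const card_ord mulVf // pnatr_eq0 -lt0n.
  rewrite (bigD1 (c i)) //= eqxx big1 ?addr0 // => S /andP[_].
  by rewrite eq_sym => /negbTE ->.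
apply/ffunP => j; rewrite ffunE sum_ffunE.
rewrite (eq_bigr (fun S : {set X} => h * \sum_i ((c i == S)%:R * (j \in S)%:R))) =>
  [|S _]; last first.
  by rewrite !ffunE /GRing.scale /= -mulrA mulr_suml.
rewrite -mulr_sumr exchange_big /=; congr (_ * _); apply: eq_bigr => i _.
rewrite (bigD1 (c i)) //= eqxx mul1r big1 ?addr0 // => S /andP[_].
by rewrite eq_sym => /negbTE ->; rewrite mul0r.
Qed.

Definition planted sg (c : 'I_n -> {set X}) : {set 'I_n * X} :=
  [set u | u.2 \in sg u.1 @: c u.1].

Lemma hidden_density_planted sg c : hidden_density sg (planted sg c) = average_ind c.
Proof.
apply/ffunP => j; rewrite !ffunE; congr (_ * _); apply: eq_bigr => i _.
by rewrite inE /= (mem_imset _ _ (@perm_inj _ _)).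
Qed.

Lemma symmetrize_ind_perm (s : {perm X}) (S : {set X}) : s \in G ->
  symmetrize G (ind R (s @: S)) = symmetrize G (ind R S).
Proof.
move=> sG; apply/ffunP => j; rewrite !symmetrizeE; congr (_ * _).
rewrite (reindex_inj (mulIg s)) /=; apply: eq_big => t; first by rewrite groupMr.
by rewrite !ffunE permM (mem_imset _ _ (@perm_inj _ _)).
Qed.

(** Feasibility concerns the true density, the average of the indicators of [sg i @: c i]. These
    sets lie in [F] by strong symmetry, as their indicators have the same symmetrization as those of
    [c i]. *)
Lemma planted_feasible (f : {set X} -> R) (F : {set {set X}}) sg c : strongly_symmetric f F G ->
  sg \in ffun_on G -> (forall i, c i \in F) -> planted sg c \in refinement_family F.
Proof.
move=> [_ Fsym] /ffun_onP sgG cF; rewrite inE; apply/asboolP.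
have -> : density R (planted sg c) = average_ind (fun i => sg i @: c i).
  by apply/ffunP => j; rewrite densityE ffunE; congr (_ * _);
    apply: eq_bigr => i _; rewrite inE.
apply: average_ind_polytope => i.
by apply/(Fsym (c i)) => //; rewrite symmetrize_ind_perm.
Qed.

(** Each [S] in [F] is used in as many rows as the integer part of [n%:R * lam S]; the remaining
    rows, at most [#|F|] of them, receive an arbitrary member [S0]. *)
Lemma polytope_rounding (F : {set {set X}}) (x : {ffun X -> R}) : polytope F x ->
  exists2 c : 'I_n -> {set X}, forall i, c i \in F &
    forall j, `|average_ind c j - x j| <= h * #|F|%:R.
Proof.
move=> [lam [lam0 lam1 ->]].
have n0 : 0 < n%:R :> R by rewrite ltr0n.
have [S0 S0F] : exists S0 : {set X}, S0 \in F.
  case: (set_0Vmem F) => [F0|[S0 S0F]]; last by exists S0.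
  by move: lam1; rewrite F0 finset.big_set0 => /esym/eqP; rewrite oner_eq0.
pose a (S : {set X}) := Num.truncn (n%:R * lam S).
have aP (S : {set X}) : S \in F -> 0 <= n%:R * lam S - (a S)%:R <= 1.
  move=> SF; have /truncn_itv/andP[a1 a2] : 0 <= n%:R * lam S.
    by rewrite mulr_ge0 ?lam0.
  by rewrite -natr1 in a2; rewrite /a; apply/andP; split; lra.
pose s := flatten [seq nseq (a U) U | U : {set X} <- enum F].
have sumE (g : {set X} -> R) : \sum_(S <- s) g S = \sum_(S in F) (a S)%:R * g S.
  rewrite big_flatten big_map /= big_enum /=; apply: eq_bigr => S _.
  by rewrite big_nseq iter_addr_0 mulr_natl.
have sizeE : (size s)%:R = \sum_(S in F) (a S)%:R :> R.
  rewrite -sum1_size natr_sum sumE; apply: eq_bigr => S _.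
  by rewrite mulr1.
have nE : n%:R = \sum_(S in F) n%:R * lam S by rewrite -mulr_sumr lam1 mulr1.
have sn : (size s <= n)%N.
  rewrite -(ler_nat R) sizeE nE; apply: ler_sum => S /aP/andP[]; lra.
pose r : R := n%:R - (size s)%:R.
have rE : r = \sum_(S in F) (n%:R * lam S - (a S)%:R) by rewrite /r sizeE {1}nE sumrB.
have r0 : 0 <= r by rewrite subr_ge0 ler_nat.
have rF : r <= #|F|%:R.
  rewrite rE; have -> : #|F|%:R = \sum_(S in F) 1 :> R by rewrite sumr_const.
  by apply: ler_sum => S /aP/andP[].
pose s' := s ++ nseq (n - size s) S0.
have s'n : size s' = n by rewrite size_cat size_nseq subnKC.
have s'F (S : {set X}) : S \in s' -> S \in F.
  rewrite mem_cat => /orP[/flattenP[t /mapP[U UF ->]]|].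
    by rewrite mem_nseq => /andP[_ /eqP ->]; rewrite mem_enum in UF.
  by rewrite mem_nseq => /andP[_ /eqP ->].
exists (fun i => nth S0 s' i); first by move=> i; apply/s'F/mem_nth; rewrite s'n.
move=> j; rewrite ffunE.
have -> : \sum_(i < n) (j \in nth S0 s' i)%:R =
    \sum_(S in F) (a S)%:R * (j \in S)%:R + r * (j \in S0)%:R :> R.
  rewrite -(big_mkord xpredT (fun i => (j \in nth S0 s' i)%:R)) -{1}s'n.
  rewrite -(big_nth S0 xpredT (fun S : {set X} => (j \in S)%:R)) big_cat sumE.
  by rewrite /= big_nseq iter_addr_0 -(mulr_natl (j \in S0)%:R) natrB.
have -> : (\sum_(S in F) lam S *: ind R S) j =
    h * \sum_(S in F) n%:R * lam S * (j \in S)%:R.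
  rewrite sum_ffunE mulr_sumr; apply: eq_bigr => S _.
  by rewrite !ffunE !mulrA mulVf ?mul1r ?gt_eqF.
rewrite -mulrBr normrM ger0_norm ?invr_ge0 //; apply: ler_wpM2l; first by rewrite invr_ge0.
apply: le_trans rF.
(* Rounding down loses [q] at [j], and the filling rows restore [r] or 0; both quantities lie
   between 0 and [r]. *)
pose q := \sum_(S in F) (n%:R * lam S - (a S)%:R) * (j \in S)%:R.
have -> : \sum_(S in F) (a S)%:R * (j \in S)%:R + r * (j \in S0)%:R -
    \sum_(S in F) n%:R * lam S * (j \in S)%:R = r * (j \in S0)%:R - q.
  have -> : q = \sum_(S in F) n%:R * lam S * (j \in S)%:R
      - \sum_(S in F) (a S)%:R * (j \in S)%:R.
    by rewrite -sumrB; apply: eq_bigr => S _; rewrite mulrBl.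
  ring.
have q0 : 0 <= q by apply: sumr_ge0 => S /aP/andP[? _]; rewrite mulr_ge0.
have qr : q <= r.
  rewrite rE; apply: ler_sum => S /aP/andP[b0 _].
  by rewrite ler_piMr // lern1 leq_b1.
have [u0 u1] : 0 <= r * (j \in S0)%:R /\ r * (j \in S0)%:R <= r.
  by rewrite mulr_ge0 // ler_piMr // lern1 leq_b1.
by rewrite ler_norml; apply/andP; split; lra.
Qed.

End HiddenInstance.

(** * Concentration of the hidden density *)

Lemma expR_le_quadratic (R : realType) (u : R) : u <= 1 / 2 ->
  expR u <= 1 + u + 2 * u ^+ 2.
Proof.
move=> u2; have v0 : 0 < 1 - u by lra.
have h1 : 1 - u <= expR (- u) by exact: expR_ge1Dx.
have h2 : expR u <= (1 - u)^-1.
  by rewrite -[u in expR u]opprK expRN lef_pV2 ?posrE ?expR_gt0.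
(* Clearing the denominator leaves [0 <= u * u * (1 - 2 * u)]. *)
apply: (le_trans h2); rewrite -[leLHS]mul1r ler_pdivrMr //.
have := mulr_ge0 (sqr_ge0 u) (_ : 0 <= 1 - 2 * u); rewrite !expr2 => h3.
have : 0 <= u * u * (1 - 2 * u) by apply: h3; lra.
lra.
Qed.

(* The exponential-moment method, with the moment parameter t / 4. *)
Lemma hoeffding (R : realType) (A : finType) (Q : {set A}) (n : nat)
    (y : 'I_n -> A -> R) (t : R) :
  0 <= t <= 2 -> (forall i a, a \in Q -> `|y i a| <= 1) ->
  (forall i, \sum_(a in Q) y i a = 0) ->
  \sum_(s in ffun_on Q) (n%:R * t <= \sum_i y i ((s : {ffun _ -> _}) i))%R%:R <=
  #|Q|%:R ^+ n * expR (- (t ^+ 2 / 8 * n%:R)) :> R.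
Proof.
move=> /andP[t0 t2] y1 y0; pose l := t / 4.
have l0 : 0 <= l by rewrite /l divr_ge0.
(* The linear term sums to zero, and [t <= 2] gives [l <= 1 / 2], the range of the quadratic
   bound. *)
have mom i : \sum_(a in Q) expR (l * y i a) <= #|Q|%:R * expR (2 * l ^+ 2).
  apply: (@le_trans _ _ (\sum_(a in Q) (1 + l * y i a + 2 * l ^+ 2))).
    apply: ler_sum => a aQ; have ya := y1 i a aQ.
    have yl : l * y i a <= l by rewrite ler_piMr // (le_trans (ler_norm _)).
    apply: (le_trans (expR_le_quadratic _)); first by rewrite /l in yl *; lra.
    rewrite lerD2l exprMn ler_wpM2l // ler_piMr ?sqr_ge0 //.
    by rewrite -real_normK ?num_real // exprn_ile1.
  rewrite big_split big_split /= -mulr_sumr y0 mulr0 addr0 !sumr_const.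
  rewrite -(mulr_natl (2 * l ^+ 2)) -[leLHS]mulr1.
  have -> : (#|Q|%:R + #|Q|%:R * (2 * l ^+ 2)) * 1 = #|Q|%:R * (1 + 2 * l ^+ 2) by ring.
  by apply: ler_wpM2l => //; exact: expR_ge1Dx.
apply: (@le_trans _ _ (\sum_(s in ffun_on Q)
    expR (- (l * (n%:R * t))) * \prod_i expR (l * y i ((s : {ffun _ -> _}) i)))).
  apply: ler_sum => s _; rewrite -expR_sum -expRD.
  case: (leP (n%:R * t)) => h; last exact: expR_ge0.
  rewrite (_ : true%:R = expR 0 :> R); last by rewrite expR0.
  rewrite ler_expR -mulr_sumr addrC subr_ge0; exact: ler_wpM2l.
rewrite -mulr_sumr.
have -> : \sum_(s in ffun_on Q) \prod_i expR (l * y i ((s : {ffun _ -> _}) i)) =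
   \prod_(i < n) \sum_(a in Q) expR (l * y i a) by rewrite bigA_distr_big.
(* Per row, the exponents -t^2 / 4 and 2 t^2 / 16 add up to -t^2 / 8. *)
have E : expR (- (t ^+ 2 / 8 * n%:R)) =
    expR (- (l * (n%:R * t))) * expR (2 * l ^+ 2) ^+ n.
  by rewrite -expRM_natl -expRD; congr expR; rewrite /l; field.
rewrite E [leRHS]mulrCA -exprMn; apply: ler_wpM2l; first exact: expR_ge0.
rewrite -[X in _ <= _ ^+ X]card_ord -prodr_const; apply: ler_prod => i _.
by rewrite mom sumr_ge0 // => a _; exact: expR_ge0.
Qed.

(** The sum counts choices of permutations, out of [#|G| ^ n]. A squared norm above [delta] forces
    some coordinate beyond [t] in absolute value; [2 * #|X|] is the union bound over coordinates and
    signs. *)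
Lemma asym_sq_concentration (R : realType) (X : finType) (G : {group {perm X}}) (n : nat)
    (S : {set 'I_n * X}) (t delta : R) : (0 < n)%N -> 0 <= t <= 2 ->
  #|X|%:R * t ^+ 2 <= delta ->
  \sum_(sg in ffun_on G) (delta < asym_sq G (hidden_density R sg S))%R%:R <=
  2 * #|X|%:R * (#|G|%:R ^+ n * expR (- (t ^+ 2 / 8 * n%:R))) :> R.
Proof.
move=> n0 t02 td; have /andP[t0 t2] := t02.
have nR : 0 < n%:R :> R by rewrite ltr0n.
pose z i j (s : {perm X}) : R := ((i, s j) \in S)%:R.
pose mean i j : R := (#|G|%:R)^-1 * \sum_(s in G) z i j s.
pose y j i s : R := z i j s - mean i j.
have G0 : 0 < #|G|%:R :> R by rewrite ltr0n cardG_gt0.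
have z01 i j s : 0 <= z i j s <= 1 by rewrite ler0n lern1 leq_b1.
have mean01 i j : 0 <= mean i j <= 1.
  rewrite /mean mulrC ler_pdivlMr ?ler_pdivrMr // mul0r mul1r -sumr_const.
  apply/andP; split; first by apply: sumr_ge0 => s _; case/andP: (z01 i j s).
  by apply: ler_sum => s _; case/andP: (z01 i j s).
have y1 j i s : `|y j i s| <= 1.
  rewrite /y ler_norml; have /andP[? ?] := z01 i j s; have /andP[? ?] := mean01 i j.
  by apply/andP; split; lra.
have y0 j i : \sum_(s in G) y j i s = 0.
  rewrite sumrB sumr_const -(mulr_natl (mean i j)) /mean mulrA mulfV ?gt_eqF //.
  by rewrite mul1r subrr.
have asymy (sg : {ffun 'I_n -> {perm X}}) j : sg \in ffun_on G ->
    n%:R * asym G (hidden_density R sg S) j = \sum_i y j i (sg i).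
  move=> sgG; rewrite asymE symmetrize_hidden_density // ffunE symmetrizeE.
  have -> : \sum_(s in G) density R S (s j) = \sum_(s in G) ((n%:R)^-1 * \sum_i z i j s).
    by apply: eq_bigr => s _; exact: densityE.
  rewrite -mulr_sumr exchange_big /= mulrCA -mulrBr mulrA mulfV ?gt_eqF // mul1r.
  by rewrite mulr_sumr -sumrB.
pose ev j sg : R := (n%:R * t <= \sum_i y j i ((sg : {ffun 'I_n -> {perm X}}) i))%R%:R +
  (n%:R * t <= \sum_i - y j i (sg i))%R%:R.
apply: (@le_trans _ _ (\sum_(sg in ffun_on G) \sum_j ev j sg)).
  apply: ler_sum => sg sgG; case: ltP => h; last first.
    by apply: sumr_ge0 => j _; rewrite addr_ge0.
  have [/existsP[j jt]|/existsPn small] :=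
    boolP [exists j, t < `|asym G (hidden_density R sg S) j|].
    rewrite (bigD1 j) //= -[leLHS]addr0; apply: lerD; last first.
      by apply: sumr_ge0 => a _; rewrite addr_ge0.
    rewrite /ev sumrN -(asymy sg j sgG) -mulrN !ler_pM2l //.
    move: jt; rewrite real_ltNge ?num_real // ler_norml negb_and -!ltNge => /orP[jt|jt].
      have -> : t <= - asym G (hidden_density R sg S) j by rewrite lerNr ltW.
      by rewrite lerDr.
    by rewrite (ltW jt) lerDl.
  exfalso; move: h; rewrite ltNge => /negP; apply; apply: le_trans td.
  rewrite mulr_natl -sumr_const; apply: ler_sum => j _.
  rewrite -expr2 -real_normK ?num_real // ler_pXn2r ?nnegrE //.
  by rewrite leNgt; exact: small.
rewrite exchange_big /=.
apply: (@le_trans _ _ (\sum_(j : X) 2 * (#|G|%:R ^+ n * expR (- (t ^+ 2 / 8 * n%:R))))).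
  have two (r : R) : 2 * r = r + r by ring.
  apply: ler_sum => j _; rewrite big_split /= two; apply: lerD.
    exact: hoeffding.
  apply: (hoeffding (y := fun i s => - y j i s)) => // [i a aG|i].
    by rewrite normrN.
  by rewrite sumrN y0 oppr0.
by rewrite sumr_const -mulrnAl -mulr_natr.
Qed.

(** * Runs of an algorithm *)

Section Runs.
Variables (R : realType) (T : finType) (Ft : {set {set T}}).
Implicit Types (v : {set T} -> R) (a : strategy R T).

(** Only value queries are recorded: all hidden instances share [Ft], so membership answers cannot
    tell them apart. *)
Fixpoint asked v a : seq {set T} :=
  match a with
  | Return _ => [::]
  | AskValue B k => B :: asked v (k (v B))
  | AskMember B k => asked v (k (B \in Ft))
  end.

Lemma size_asked v a : size (asked v a) = value_queries v Ft a.
Proof. by elim: a => //= B k IH; rewrite IH. Qed.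

Lemma output_agree v v' a : {in asked v a, v' =1 v} -> output v' Ft a = output v Ft a.
Proof.
elim: a => //= B k IH agree; last exact: IH.
rewrite agree ?mem_head //; apply: IH => Q Qa.
by rewrite agree // in_cons Qa orbT.
Qed.

(** The run on [v0] fixes a list of sets: the queries and also the output, whence the final 1. If
    [v i] agrees with [v0] on this list, the outputs and their values coincide; otherwise some
    disagreement pays the maximal value [M]. *)
Lemma sum_output_bound (I : Type) (s : seq I) (v : I -> {set T} -> R) v0 a (M B : R) :
  nonneg_setfun v0 -> (forall i S, 0 <= v i S <= M) -> 0 <= M ->
  (forall S, \sum_(i <- s) (v i S != v0 S)%:R <= B) ->
  \sum_(i <- s) v i (output (v i) Ft a) <=
  (size s)%:R * v0 (output v0 Ft a) + M * B * ((value_queries v0 Ft a)%:R + 1).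
Proof.
move=> v00 vM M0 badB; pose l := output v0 Ft a :: asked v0 a.
apply: (@le_trans _ _ (\sum_(i <- s) (v0 (output v0 Ft a) +
    M * \sum_(S <- l) (v i S != v0 S)%:R))).
  apply: ler_sum => i _.
  have [/allP agree|/allPn[S Sl neq]] := boolP (all (fun S => v i S == v0 S) l).
    have outE : output (v i) Ft a = output v0 Ft a.
      by apply: output_agree => S Sa; apply/eqP/agree; rewrite in_cons Sa orbT.
    rewrite outE (eqP (agree _ _)) ?mem_head // lerDl mulr_ge0 // sumr_ge0 //.
  have /andP[_ vi] := vM i (output (v i) Ft a).
  apply: (le_trans vi); rewrite -[leLHS]add0r; apply: lerD; first exact: v00.
  rewrite ler_peMr // (big_rem S Sl) /= neq lerDl sumr_ge0 //.
rewrite big_split /= big_const_seq count_predT iter_addr_0 -[_ *+ size s]mulr_natl lerD2l.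
rewrite -mulr_sumr -mulrA ler_wpM2l // exchange_big /=.
apply: (@le_trans _ _ (\sum_(S <- l) B)); first by apply: ler_sum.
by rewrite big_const_seq count_predT iter_addr_0 /= size_asked natr1 mulr_natr.
Qed.

End Runs.

(** * Expectations over the random seed *)

Section Measurability.
Variables (R : realType) (d : measure_display) (Omega : measurableType d).

Lemma measurable_discrete (U : countType) (g : Omega -> U) (r : U -> R) :
  (forall u, measurable [set w | g w = u]%classic) ->
  measurable_fun setT (EFin \o (r \o g)).
Proof.
move=> gm; apply/measurable_EFinP => _ Y mY; rewrite setTI.
have -> : ((r \o g) @^-1` Y = \bigcup_(u in [set u | Y (r u)]) [set w | g w = u])%classic.
  by apply/seteqP; split=> [w Yw|w [u Yu /= gwu]]; [exists (g w)|rewrite /preimage /= gwu].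
rewrite bigcup_mkcond; apply: countable_bigcupT_measurable.
  exact: countableP.
by move=> u; case: ifP => _ //; exact: measurable0.
Qed.

End Measurability.

Section AveragedGuarantee.
Variables (R : realType) (X : finType) (d : measure_display) (Omega : measurableType d).
Variables (P : probability Omega R) (A : rand_algorithm R X Omega).
Variables (n : nat) (Ft : {set {set 'I_n * X}}).

(** Summing the guarantees over [s] under the integral lets [sum_output_bound] be applied seed by
    seed, so that feasibility and the number of queries are those of the run on [v0]. *)
Lemma averaged_guarantee (I : eqType) (s : seq I) (v : I -> {set 'I_n * X} -> R) v0
    (a U M B r : R) :
  nonneg_setfun v0 -> (forall i S, 0 <= v i S <= M) -> 0 <= M -> 0 <= B -> 0 <= U ->
  (forall S, \sum_(i <- s) (v i S != v0 S)%:R <= B) ->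
  (forall S, S \in Ft -> v0 S <= U) ->
  {ae P, forall w, output v0 Ft (strat A n w) \in Ft} ->
  ('E_P[fun w => (value_queries v0 Ft (strat A n w))%:R] <= r%:E)%E ->
  {in s, forall i, (a%:E <= 'E_P[fun w => v i (output (v i) Ft (strat A n w))])%E} ->
  (size s)%:R * a <= (size s)%:R * U + M * B * (r + 1).
Proof.
move=> v00 vM M0 B0 U0 badB v0U feas; rewrite unlock => qr va.
pose q w : R := (value_queries v0 Ft (strat A n w))%:R.
have mo i : measurable_fun setT (EFin \o (fun w => v i (output (v i) Ft (strat A n w)))).
  by apply: measurable_discrete => S; exact: measurable_output.
have mq : measurable_fun setT (EFin \o q).
  by apply: (@measurable_discrete _ _ _ nat _ (fun m => m%:R)) => m;
    exact: measurable_value_queries.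
have q0 w : 0 <= q w by [].
have MB0 : 0 <= M * B by rewrite mulr_ge0.
rewrite -lee_fin.
apply: (@le_trans _ _ (\sum_(i <- s) \int[P]_w (v i (output (v i) Ft (strat A n w)))%:E)%E).
  have -> : ((size s)%:R * a)%:E = (\sum_(i <- s) a%:E)%E.
    by rewrite sumEFin big_const_seq count_predT iter_addr_0 mulr_natl.
  by rewrite big_seq [leRHS]big_seq; apply: lee_sum => i; exact: va.
rewrite -ge0_integral_sum //; last first.
  by move=> i w _; rewrite lee_fin; case/andP: (vM i (output (v i) Ft (strat A n w))).
apply: (@le_trans _ _ (\int[P]_w (((size s)%:R * U + M * B)%:E + (M * B)%:E * (q w)%:E))%E).
  apply: ae_ge0_le_integral => //.
  - move=> w _; apply: sume_ge0 => i _.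
    by rewrite lee_fin; case/andP: (vM i (output (v i) Ft (strat A n w))).
  - exact: emeasurable_sum.
  - by move=> w _; rewrite -EFinM -EFinD lee_fin !addr_ge0 ?mulr_ge0.
  - by apply: emeasurable_funD => //; apply: measurable_funeM.
  apply: filterS feas => w out _; rewrite sumEFin -EFinM -EFinD lee_fin.
  apply: (le_trans (sum_output_bound _ _ v00 vM M0 badB)).
  have := ler_wpM2l (ler0n R (size s)) (v0U _ out); rewrite -/(q w); lra.
rewrite ge0_integralD //; last 3 first.
- by move=> w _; rewrite lee_fin addr_ge0 ?mulr_ge0.
- by move=> w _; rewrite -EFinM lee_fin mulr_ge0.
- exact: measurable_funeM.
rewrite integral_cst // [X in (_ * X + _)%E](probability_setT P) mule1.
rewrite ge0_integralZl //; last first.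
  by move=> w _; rewrite lee_fin.
have := lee_wpmul2l (_ : (0 <= (M * B)%:E)%E) qr; rewrite lee_fin => /(_ MB0) h.
apply: (le_trans (leeD2l _ h)).
by rewrite -EFinM -EFinD lee_fin; lra.
Qed.

End AveragedGuarantee.

(** * The hardness result *)

Section Optimum.
Variables (R : realType) (X : finType) (f : {set X} -> R) (F : {set {set X}}).
Variable G : {group {perm X}}.
Hypothesis f_ge0 : nonneg_setfun f.

Lemma polytope_in_box (x : {ffun X -> R}) : polytope F x -> in_box 0 1 x.
Proof.
move=> [lam [lam0 lam1 ->]] j.
have -> : (\sum_(S in F) lam S *: ind R S) j = \sum_(S in F) lam S * (j \in S)%:R.
  by rewrite sum_ffunE; apply: eq_bigr => S _; rewrite !ffunE.
apply/andP; split.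
  by apply: sumr_ge0 => S SF; rewrite mulr_ge0 ?lam0.
by rewrite -[leRHS]lam1; apply: ler_sum => S SF; rewrite ler_piMr ?lam0 // lern1 leq_b1.
Qed.

Lemma symmetrize_gt0 (x : {ffun X -> R}) j : in_box 0 1 x -> 0 < x j ->
  0 < symmetrize G x j.
Proof.
move=> xb xj; rewrite symmetrizeE mulr_gt0 ?invr_gt0 ?card_group_gt0 //.
rewrite (bigD1 1%g) //= perm1 ltr_pwDl // sumr_ge0 // => s _.
by case/andP: (xb (s j)).
Qed.

(* The support of the product distribution with marginals [x] is contained in
   that of its symmetrization. *)
Lemma multilinear_symmetrize_gt0 (x : {ffun X -> R}) : in_box 0 1 x ->
  0 < multilinear f x -> 0 < multilinear f (symmetrize G x).
Proof.
move=> xb; have xb' := @symmetrize_in_box _ _ G _ _ _ xb.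
rewrite !multilinearE => Fx.
have [S fS wS] : exists2 S, 0 < f S & 0 < weight S x.
  apply: contrapT => none; move: Fx; rewrite big1 ?ltxx // => S _.
  have := f_ge0 S; rewrite le_eqVlt => /orP[/eqP <-|fS]; first by rewrite mul0r.
  have := weight_ge0 S xb; rewrite le_eqVlt => /orP[/eqP <-|wS]; first by rewrite mulr0.
  by case: none; exists S.
rewrite (bigD1 S) //= ltr_pwDl //; last first.
  by apply: sumr_ge0 => U _; rewrite mulr_ge0 // weight_ge0.
rewrite mulr_gt0 // prodr_gt0 // => i _.
have : (if i \in S then x i else 1 - x i) != 0.
  apply: contraTneq wS => z; rewrite /weight (bigD1 i) //= z mul0r ltxx //.
have /andP[x0 x1] := xb i; case: ifP => _ nz.
  by apply: symmetrize_gt0 => //; rewrite lt_neqAle eq_sym nz.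
(* Outside [S] it is [1 - x] that must stay positive, which is the same claim for the complementary
   point. *)
pose y : {ffun X -> R} := [ffun j => 1 - x j].
have -> : 1 - symmetrize G x i = symmetrize G y i.
  rewrite !symmetrizeE.
  rewrite [in RHS](eq_bigr (fun s : {perm X} => 1 - x (s i))) => [|s _]; last by rewrite ffunE.
  rewrite sumrB sumr_const mulrBr mulVf //.
  by rewrite gt_eqF // card_group_gt0.
apply: symmetrize_gt0 => [j|]; last by rewrite ffunE lt_neqAle eq_sym nz subr_ge0.
by rewrite ffunE; have /andP[? ?] := xb j; apply/andP; split; lra.
Qed.

Lemma OPTbar_ubound (x : {ffun X -> R}) : polytope F x ->
  multilinear f (symmetrize G x) <= OPTbar f F G.
Proof.
move=> xP; apply: ub_le_sup; last by exists x.
exists (\sum_S f S) => _ [y yP <-]; apply: multilinear_le_sum => //.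
exact/symmetrize_in_box/polytope_in_box.
Qed.

Lemma OPT_approached (e : R) : 0 < OPT f F -> 0 < e ->
  exists2 x, polytope F x & OPT f F - e < multilinear f x.
Proof.
move=> O0 e0.
have hs : has_sup [set multilinear f x | x in [set x | polytope F x]]%classic.
  (* [sup] is 0 for a set without a supremum, so a positive [OPT f F] guarantees one. *)
  by apply: contrapT => /sup_out O0'; move: O0; rewrite /OPT O0' ltxx.
by have [_ [x xP <-] h] := sup_adherent e0 hs; exists x.
Qed.

(** Makes the approximation factor and the slack in the final comparison strictly positive. *)
Lemma OPTbar_gt0 : 0 < OPT f F -> 0 < OPTbar f F G.
Proof.
move=> O0; have [x xP] := OPT_approached O0 O0; rewrite subrr => Fx.
apply: lt_le_trans (OPTbar_ubound xP).
exact: multilinear_symmetrize_gt0 (polytope_in_box xP) Fx.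
Qed.

End Optimum.

(** * Averaging over the hidden permutations *)

Section Hardness.
Variables (R : realType) (X : finType) (f : {set X} -> R) (F : {set {set X}}).
Variables (G : {group {perm X}}) (eps : R).
Hypotheses (f_ge0 : nonneg_setfun f) (f_submod : submodular f).
Hypothesis fFG_sym : strongly_symmetric f F G.
Hypotheses (OPT_gt0 : 0 < OPT f F) (eps_gt0 : 0 < eps).

Local Notation k := (#|X|%:R : R).
Local Notation O := (OPT f F).
Local Notation Ob := (OPTbar f F G).

(** Stated for any class containing the instances built from hidden densities, so that the general
    and the monotone class are treated at once. *)
Lemma hidden_instances_hard (C : instance_class R X) :
  (forall n (u : {ffun X -> R} -> R) sg, (0 < n)%N ->
     (forall x, in_box 0 1 x -> 0 <= u x) -> locally_submodular u (n%:R)^-1 ->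
     (monotone_setfun f -> locally_monotone u (n%:R)^-1) ->
     C n (fun S => u (hidden_density R sg S)) (refinement_family R n F)) ->
  requires_exponentially_many_queries C ((1 + eps) * symmetry_gap f F G).
Proof.
move=> inC.
have Ob0 : 0 < Ob by exact: OPTbar_gt0.
have [alpha [alphaE alpha0 alphaO]] : exists alpha : R,
    [/\ (1 + eps) * symmetry_gap f F G = alpha, 0 < alpha & alpha * O = (1 + eps) * Ob].
  exists ((1 + eps) * symmetry_gap f F G); rewrite /symmetry_gap; split=> //.
    by rewrite mulr_gt0 ?divr_gt0 // addr_gt0.
  by rewrite mulrA divfK // gt_eqF.
rewrite {}alphaE.
have q0 : 0 < 3 * alpha + 2 by lra.
(* The losses, [3 * alpha] times [e1] in the optimum and [2 * e1] in the output, are to use up half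
   of the slack [eps * Ob]. *)
have [e1 e10 e1E] : exists2 e1 : R, 0 < e1 & (3 * alpha + 2) * e1 = eps * Ob / 2.
  exists (eps * Ob / 2 / (3 * alpha + 2)); first by rewrite !divr_gt0 ?mulr_gt0.
  by rewrite mulrC divfK // gt_eqF.
have fG S s : s \in G -> f S = f (s @: S) by exact: fFG_sym.1.
have [Phi [Gam [delta [h0 [[d0 h00 ranges Gam_bar Phi_Gam] loc]]]]] :=
  smoothing_exists f_ge0 f_submod fG e10.
have [xs xsP xsO] := OPT_approached OPT_gt0 e10.
pose M := \sum_S f S + e1.
have M0 : 0 <= M by rewrite addr_ge0 ?sumr_ge0 // ltW.
pose Lip : R := \sum_i (\sum_S `|diff_set i f S|) * 2 ^+ #|X|.
have Lip0 : 0 <= Lip by apply: sumr_ge0 => i _; rewrite mulr_ge0 ?sumr_ge0 ?exprn_ge0.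
(* Small enough for [k * t ^+ 2 <= delta], and within the range of [hoeffding]. *)
pose t := Num.min 1 (delta / (k + 1)).
have k1 : 0 < k + 1 by rewrite ltr_wpDl.
have t0 : 0 < t by rewrite lt_min ltr01 divr_gt0.
have t1 : t <= 1 by rewrite ge_min lexx.
have t02 : 0 <= t <= 2 by rewrite ltW //= (le_trans t1) // ler1n.
have td : k * t ^+ 2 <= delta.
  have tdk : t * (k + 1) <= delta by rewrite -ler_pdivlMr // ge_min lexx orbT.
  have tt : t ^+ 2 <= t by rewrite expr2 ler_piMl // ltW.
  have := ler_wpM2l (ler0n R #|X|) tt; nra.
pose tau := t ^+ 2 / 8.
have tau0 : 0 < tau by rewrite divr_gt0 // exprn_gt0.
(* The ground set has n k elements, so the query bound uses at most half of the exponent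
   [tau * n%:R]. *)
pose c := tau / (2 * (k + 1)).
have c0 : 0 < c by rewrite divr_gt0 // mulr_gt0.
(* [n1] makes the step 1/n admissible for [loc], [n2] bounds the error of rounding [xs] to rows, and
   [n3] lets the exponential beat the constant factors. *)
have [n1 n10 n1P] : exists2 m, (0 < m)%N & (m%:R)^-1 * 1 <= h0 by exact: archimedean_div.
have [n2 n20 n2P] : exists2 m, (0 < m)%N & (m%:R)^-1 * (Lip * (k * #|F|%:R)) <= e1.
  by apply: archimedean_div => //; rewrite !mulr_ge0.
have [n3 n30 n3P] : exists2 m, (0 < m)%N & (m%:R)^-1 * (8 * M * k / e1) <= tau.
  by apply: archimedean_div => //; rewrite divr_ge0 ?mulr_ge0 // ltW.
exists c, (maxn n1 (maxn n2 n3)); split => // d Omega P A approx n.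
rewrite !geq_max => /andP[nn1 /andP[nn2 nn3]] n0.
have nR : 0 < n%:R :> R by rewrite ltr0n.
have inv_n a b (m : nat) : (m <= n)%N -> (0 < m)%N -> 0 <= a ->
    (m%:R)^-1 * a <= b -> (n%:R)^-1 * a <= b :> R.
  move=> mn m0 a0; apply: le_trans; apply: ler_wpM2r => //.
  by rewrite lef_pV2 ?posrE ?ltr0n // ler_nat.
have [] := loc (n%:R)^-1.
  by rewrite invr_gt0 nR /= -[leLHS]mulr1 (inv_n _ _ n1).
move=> Phi_sub Gam_sub mono.
pose Ft := refinement_family R n F.
(* The identity gives the plain density; by [Gam_bar], any choice in [G] would define the same
   [v0]. *)
pose id1 : {ffun 'I_n -> {perm X}} := [ffun=> 1%g].
have id1G : id1 \in ffun_on G by apply/ffun_onP => i; rewrite ffunE group1.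
pose v (sg : {ffun 'I_n -> {perm X}}) (S : {set 'I_n * X}) := Phi (hidden_density R sg S).
pose v0 (S : {set 'I_n * X}) := Gam (hidden_density R id1 S).
have boxh sg (S : {set 'I_n * X}) : in_box 0 1 (hidden_density R sg S).
  exact: hidden_density_in_box.
have Cv sg : C n (v sg) Ft.
  by apply: inC => // [x /ranges[]//|fm]; have [] := mono fm.
have Cv0 : C n v0 Ft.
  by apply: inC => // [x /ranges[]//|fm]; have [] := mono fm.
(* The symmetric instance is the hard one: with too few expected queries on it, the guarantees
   cannot all hold on the instances [v sg]. *)
exists v0, Ft; split => //; rewrite leNgt; apply/negP => few.
pose Sg := enum (ffun_on G : {pred {ffun 'I_n -> {perm X}}}).
pose N : R := #|G|%:R ^+ n.
have N0 : 0 < N by rewrite exprn_gt0 // card_group_gt0.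
have sizeSg : (size Sg)%:R = N.
  by rewrite /Sg -cardE card_ffun_on card_ord natrX.
pose B : R := 2 * k * (N * expR (- (tau * n%:R))).
pose r := expR (c * #|{: 'I_n * X}|%:R).
have H : (size Sg)%:R * (alpha * (O - 3 * e1)) <=
    (size Sg)%:R * (Ob + e1) + M * B * (r + 1).
  apply: (@averaged_guarantee _ _ _ _ P A n Ft _ Sg v v0).
  - by move=> S; have [] := ranges _ (boxh id1 S).
  - move=> sg S; have [p0 _ pF _] := ranges _ (boxh sg S); rewrite p0 /=.
    have := multilinear_le_sum f_ge0 (boxh sg S).
    move: pF; rewrite ler_norml => /andP[_ pF] pM; rewrite /M /v; lra.
  - exact: M0.
  - by rewrite !mulr_ge0 ?expR_ge0 // ltW.
  - by rewrite addr_ge0 // ltW.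
  - move=> S; rewrite /Sg big_enum /=.
    apply: le_trans (asym_sq_concentration G S n0 t02 td); apply: ler_sum => sg sgG.
    (* At a nearly symmetric hidden density, [Phi] equals [Gam], which sees only the
       symmetrization. *)
    rewrite ler_nat; case: (ltP delta) => [_|small]; first exact: leq_b1.
    have -> : v sg S = v0 S; last by rewrite eqxx.
    by rewrite /v /v0 Phi_Gam //; apply: Gam_bar; rewrite !symmetrize_hidden_density.
  - move=> S; rewrite inE => /asboolP SP; have [_ _ _ gF] := ranges _ (boxh id1 S).
    have := OPTbar_ubound G f_ge0 SP.
    move: gF; rewrite symmetrize_hidden_density // ler_norml => /andP[_ gF] oF.
    rewrite /v0; lra.
  - exact: (approx n v0 Ft Cv0).1.
  - exact: ltW.
  - move=> sg; rewrite mem_enum => sgG.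
    apply: le_trans (approx n (v sg) Ft (Cv sg)).2; rewrite lee_fin.
    apply: ler_wpM2l; first exact: ltW.
    (* The optimum of [v sg] is at least [O - 3 * e1]: one [e1] each for the choice of [xs], for its
       rounding, and for replacing the extension by [Phi]. *)
    have [col colF near] := polytope_rounding n0 xsP.
    have feas := planted_feasible n0 fFG_sym sgG colF.
    apply: le_trans (le_bigmax_cond _ _ feas).
    rewrite /v hidden_density_planted //.
    have avgP := average_ind_polytope R n0 colF.
    have avgb := polytope_in_box avgP; have xsb := polytope_in_box xsP.
    have [_ _ pF _] := ranges _ avgb.
    have lipP i z : in_box (-1) 2 z -> `|multilinear (diff_set i f) z| <= Lip.
      move=> zb; apply: (le_trans (multilinear_bound _ zb)); rewrite /Lip (bigD1 i) //= lerDl.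
      by apply: sumr_ge0 => j _; rewrite mulr_ge0 ?sumr_ge0 ?exprn_ge0.
    have lip := multilinear_lipschitz lipP (box_widen xsb) (box_widen avgb).
    have l1 : Lip * l1norm (average_ind R col - xs) <= e1.
      have l1' : l1norm (average_ind R col - xs) <= (n%:R)^-1 * (k * #|F|%:R).
        rewrite mulrCA mulr_natl -sumr_const; apply: ler_sum => j _.
        by have := near j; rewrite !ffunE.
      apply: (le_trans (ler_wpM2l Lip0 l1')); rewrite mulrCA.
      by apply: (inv_n _ _ n2) => //; rewrite !mulr_ge0.
    move: pF lip; rewrite !ler_norml => /andP[pF _] /andP[lip _].
    lra.
rewrite sizeSg in H.
(* Half of the exponent. As [r <= E], the error divided by [N] is at most [4 * M * k / E], and [n3]
   makes this at most [e1]. *)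
pose E := expR (tau * n%:R / 2).
have E0 : 0 < E by exact: expR_gt0.
have EE : expR (- (tau * n%:R)) = E^-1 * E^-1.
  by rewrite -!expRN -expRD; congr expR; field.
have tn0 : 0 < tau * n%:R by rewrite mulr_gt0.
have E1 : 1 <= E by apply: le_trans (expR_ge1Dx _); rewrite lerDl divr_ge0 // ltW.
have rE : r <= E.
  rewrite /r /E ler_expR card_prod card_ord natrM /c.
  have -> : tau / (2 * (k + 1)) * (n%:R * k) = tau * n%:R / 2 * (k / (k + 1)).
    by field; rewrite gt_eqF.
  rewrite ler_piMr ?divr_ge0 ?(ltW tn0) // ler_pdivrMr // mul1r lerDl //.
have ME : 4 * M * k <= e1 * E.
  have h : 8 * M * k / e1 <= tau * n%:R.
    rewrite -ler_pdivrMr // mulrC; apply: (inv_n _ _ n3) => //.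
    by rewrite divr_ge0 ?mulr_ge0 // ltW.
  rewrite ler_pdivrMr // in h.
  have h2 : tau * n%:R / 2 <= E by apply: le_trans (expR_ge1Dx _); rewrite lerDr.
  have := ler_wpM2l (ltW e10) h2; lra.
have HE : M * (2 * k * expR (- (tau * n%:R))) * (r + 1) <= e1.
  have A0 : 0 <= M * (2 * k * (E^-1 * E^-1)).
    by rewrite !mulr_ge0 // invr_ge0 ltW.
  have r2 : r + 1 <= 2 * E by lra.
  rewrite EE; apply: (le_trans (ler_wpM2l A0 r2)).
  have -> : M * (2 * k * (E^-1 * E^-1)) * (2 * E) = 4 * M * k / E by field; rewrite gt_eqF.
  by rewrite ler_pdivrMr.
have : N * (alpha * (O - 3 * e1)) <= N * (Ob + e1 + e1).
  apply: (le_trans H); rewrite [leRHS]mulrDr lerD2l.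
  have -> : M * B * (r + 1) = N * (M * (2 * k * expR (- (tau * n%:R))) * (r + 1)).
    by rewrite /B; ring.
  by apply: ler_wpM2l => //; exact: ltW.
rewrite ler_pM2l // => fin.
(* By [alphaO] and [e1E], [fin] reads [(1 + eps) * Ob <= Ob + eps * Ob / 2]. *)
have := mulr_gt0 eps_gt0 Ob0; lra.
Qed.

End Hardness.

Theorem theorem1p8 (R : realType) (X : finType) (f : {set X} -> R)
    (F : {set {set X}}) (G : {group {perm X}})
    (f_ge0 : nonneg_setfun f) (f_submod : submodular f)
    (fFG_sym : strongly_symmetric f F G)
    (OPT_gt0 : 0 < OPT f F)
    (eps : R) (eps_gt0 : 0 < eps) :
  requires_exponentially_many_queries
    (refinement_class F) ((1 + eps) * symmetry_gap f F G)
  /\ (monotone_setfun f ->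
      requires_exponentially_many_queries
        (monotone_refinement_class F) ((1 + eps) * symmetry_gap f F G)).
Proof.
have inC n (u : {ffun X -> R} -> R) sg : (0 < n)%N ->
    (forall x, in_box 0 1 x -> 0 <= u x) -> locally_submodular u (n%:R)^-1 ->
    refinement_class F (fun S => u (hidden_density R sg S)) (refinement_family R n F).
  move=> n0 u0 us; split=> //.
  - by move=> S; exact/u0/hidden_density_in_box.
  - exact: hidden_submodular.
  - exact: refinement_familyP.
split=> [|fm].
  by apply: hidden_instances_hard => // n u sg n0 u0 us _; exact: inC.
apply: hidden_instances_hard => // n u sg n0 u0 us um; split; first exact: inC.
exact/hidden_monotone/um.
Qed.
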